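(* Let $K$ be a field and let $A$ be a finitely generated prime (unital, associative) $K$-algebra of GK dimension less than $3$. If $A$ is not PI and $A$ has no nonzero locally nilpotent ideals, then the extended centre of $A$ is algebraic over $K$.
   Context: All algebras are associative with identity; ideals are two-sided. An algebra is PI if it satisfies a (nontrivial) polynomial identity. An ideal $I$ of $A$ is locally nilpotent if for every finite-dimensional $K$-subspace $W\subseteq I$ there is $n\ge 1$ with $W^n=(0)$. GK dimension: for a $K$-subspace $V$ of $A$, $V^n$ denotes the $K$-span of all products of $n$ elements of $V$. A frame for $A$ is a finite-dimensional $K$-subspace $V$ with $1\in V$ that generates $A$ as a $K$-algebra. For finitely generated $A$ with frame $V$, $$\operatorname{GKdim}(A)=\limsup_{n\to\infty}\frac{\log(\dim_K V^n)}{\log n},$$ which does not depend on the choice of $V$. Extended centre: for a prime algebra $A$, the Martindale ring of quotients is the set of equivalence classes of pairs $(I,f)$, where $I$ is a nonzero ideal of $A$ and $f:I\to A$ is a homomorphism of right $A$-modules, with $(I,f)\sim(J,g)$ if $f$ and $g$ agree on some nonzero ideal contained in $I\cap J$; addition is pointwise on $I\cap J$, and the product of the classes of $(I,f)$ and $(J,g)$ is the class of $(JI, f\circ g)$. It contains $A$ via left multiplications. The extended centre of $A$ is the centre of this ring; it is a field containing $K$. *)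

(* Defs.v *)
From HB Require Import structures.
From mathcomp Require Import all_boot all_order all_algebra.
From mathcomp Require Import all_classical all_reals all_analysis.
From mathcomp Require Import -(notations) monalg.

Set Implicit Arguments.
Unset Strict Implicit.
Unset Printing Implicit Defensive.

Import GRing.Theory.

Local Open Scope classical_set_scope.
Local Open Scope quotient_scope.
Local Open Scope ring_scope.

Section Subspaces.
Variables (K : fieldType) (V : lmodType K).

(* In arbitrary dimension, unlike the library's vector spaces. *)
Definition span (X : set V) : set V :=
  smallest (fun W : set V => GRing.submod_closed (mem W)) X.

Definition lin_indep n (b : 'I_n -> V) : Prop :=
  forall c : 'I_n -> K, \sum_(i < n) c i *: b i = 0 -> forall i, c i = 0.

Definition has_dim (W : set V) (n : nat) : Prop :=
  exists2 b : 'I_n -> V, lin_indep b & W = span (range b).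

Definition fin_dim (W : set V) : Prop := exists n, has_dim W n.

(* The dimension of a finite-dimensional subspace; meaningless (equal to 0)
   when W is not one. *)
Definition dim (W : set V) : nat := xget 0%N (has_dim W).

End Subspaces.

Section Algebras.
Variables (K : fieldType) (A : algType K).

(* W^n; in particular W^0 = K. *)
Definition space_exp (W : set A) (n : nat) : set A :=
  span [set \prod_(i < n) x i | x in [set x : 'I_n -> A | forall i, W (x i)]].

Definition is_frame (W : set A) : Prop :=
  [/\ fin_dim W, W 1 &
      smallest (fun B : set A => GRing.subalg_closed (mem B)) W = setT].

(* The terms of index 0 and 1, whose denominator is 0, are irrelevant to the
   upper limit. *)
Definition GKdim (R : realType) (W : set A) : \bar R :=
  limn_esup (fun n => (ln (dim (space_exp W n))%:R / ln n%:R)%:E).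

(* Noncommutative polynomials in countably many variables are the elements of
   the monoid algebra over K of the free monoid on nat. *)
Definition is_PI : Prop :=
  exists2 p : malg (fmonom nat) K, p != 0 &
    forall x : nat -> A,
      mmap (in_alg A)
        (fun w => \prod_(i <- fmonom_val w) x i) p = 0.

Definition is_ideal (I : set A) : Prop :=
  [/\ zmod_closed (mem I), forall a x, I x -> I (a * x)
    & forall a x, I x -> I (x * a)].

(* The algebra is nonzero, since 1 != 0 in an algType. *)
Definition prime_algebra : Prop :=
  forall I J : set A, is_ideal I -> is_ideal J ->
    (forall x y, I x -> J y -> x * y = 0) -> I = [set 0] \/ J = [set 0].

Definition locally_nilpotent (I : set A) : Prop :=
  forall W : set A, fin_dim W -> W `<=` I ->
    exists2 n, (0 < n)%N & space_exp W n = [set 0].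

Definition ideal_mul (I J : set A) : set A :=
  span [set z | exists x y, [/\ I x, J y & z = x * y]].

(* Pairs (I, f): only the restriction of the function phfun to phdom matters,
   and two functions which agree there give equivalent pairs. *)
Record partial_hom := PartialHom {
  phdom : set A;
  phfun : A -> A;
  phdom_ideal : is_ideal phdom;
  phdom_neq0 : phdom <> [set 0];
  phfunD : forall x y, phdom x -> phdom y -> phfun (x + y) = phfun x + phfun y;
  phfunM : forall x a, phdom x -> phfun (x * a) = phfun x * a }.

Definition ph_equiv (f g : partial_hom) : Prop :=
  exists L : set A, [/\ is_ideal L, L <> [set 0], L `<=` phdom f `&` phdom g
    & forall x, L x -> phfun f x = phfun g x].

End Algebras.

Section SubspaceTheory.
Variables (K : fieldType) (V : lmodType K).
Implicit Types (X W : set V).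

Lemma submod_closedP W : GRing.submod_closed (mem W) <->
  W 0 /\ forall a x y, W x -> W y -> W (a *: x + y).
Proof.
split=> [[W0 WD]|[W0 WD]]; split.
- by move: W0; rewrite inE.
- by move=> a x y Wx Wy; have := WD a x y; rewrite !inE; apply.
- by rewrite inE.
- by move=> a x y; rewrite !inE; apply: WD.
Qed.

Lemma span_sub X : X `<=` span X.
Proof. exact: sub_gen_smallest. Qed.

Lemma span0 X : span X 0.
Proof. by move=> W [/submod_closedP[]]. Qed.

Lemma spanP X a x y : span X x -> span X y -> span X (a *: x + y).
Proof.
move=> Xx Xy W [sW XW]; have /submod_closedP[_] := sW; apply.
  by apply: Xx.
by apply: Xy.
Qed.

Lemma span_min X W : W 0 -> (forall a x y, W x -> W y -> W (a *: x + y)) ->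
  X `<=` W -> span X `<=` W.
Proof. by move=> W0 WD XW; apply: smallest_sub => //; apply/submod_closedP. Qed.

End SubspaceTheory.

Section IdealTheory.
Variables (K : fieldType) (A : algType K).
Implicit Types (I J L : set A).

Lemma idealP I : is_ideal I <-> [/\ I 0,
  forall x y, I x -> I y -> I (x - y), forall a x, I x -> I (a * x)
  & forall a x, I x -> I (x * a)].
Proof.
split=> [[[I0 IB] Il Ir]|[I0 IB Il Ir]]; split => //.
- by move: I0; rewrite inE.
- by move=> x y Ix Iy; have := IB x y; rewrite !inE; apply.
- by split; rewrite ?inE // => x y; rewrite !inE; apply: IB.
Qed.

Lemma ideal0 I : is_ideal I -> I 0. Proof. by case/idealP. Qed.

Lemma idealN I x : is_ideal I -> I x -> I (- x).
Proof. by case/idealP => I0 IB _ _ Ix; rewrite -sub0r; apply: IB. Qed.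

Lemma idealD I x y : is_ideal I -> I x -> I y -> I (x + y).
Proof.
by move=> iI Ix Iy; have /idealP[_ IB _ _] := iI; rewrite -[y]opprK;
  apply: IB => //; apply: idealN.
Qed.

Lemma idealMl I a x : is_ideal I -> I x -> I (a * x).
Proof. by case/idealP => _ _ Il _; apply: Il. Qed.

Lemma idealMr I a x : is_ideal I -> I x -> I (x * a).
Proof. by case/idealP => _ _ _; apply. Qed.

Lemma idealZD I (k : K) x y : is_ideal I -> I x -> I y -> I (k *: x + y).
Proof.
by move=> iI Ix Iy; apply: idealD => //; rewrite -mulr_algl; apply: idealMl.
Qed.

Lemma neq_set0P I : is_ideal I -> I <> [set 0] <-> exists2 x, I x & x <> 0.
Proof.
move=> iI; split=> [I0|[x Ix x0] I0]; last by move: Ix; rewrite I0.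
apply: contrapT => nx; apply: I0; apply/seteqP; split=> [x Ix|x ->] /=.
  by apply: contrapT => x0; apply: nx; exists x.
exact: ideal0.
Qed.

Lemma idealT : is_ideal [set: A].
Proof. by apply/idealP; split. Qed.

Lemma setT_neq0 : [set: A] <> [set 0].
Proof. by apply/(neq_set0P idealT); exists 1 => //; apply/eqP/oner_neq0. Qed.

Lemma idealI I J : is_ideal I -> is_ideal J -> is_ideal (I `&` J).
Proof.
move=> /idealP[I0 IB Il Ir] /idealP[J0 JB Jl Jr]; apply/idealP; split.
- by split.
- by move=> x y [? ?] [? ?]; split; [apply: IB|apply: JB].
- by move=> a x [? ?]; split; [apply: Il|apply: Jl].
- by move=> a x [? ?]; split; [apply: Ir|apply: Jr].
Qed.

Lemma ideal_mulP I J : is_ideal I -> is_ideal J -> is_ideal (ideal_mul I J).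
Proof.
move=> iI iJ; apply/idealP; split.
- exact: span0.
- move=> x y Xx Xy; rewrite -scaleN1r addrC; exact: spanP.
- move=> a; apply: (@span_min _ _ _ [set z | ideal_mul I J (a * z)]) => /=.
  + rewrite mulr0; exact: span0.
  + move=> k x y Xx Xy; rewrite mulrDr -scalerAr; exact: spanP.
  + move=> _ [x [y [Ix Jy ->]]] /=; apply: span_sub.
    exists (a * x), y; split; rewrite ?mulrA //; exact: idealMl.
- move=> a; apply: (@span_min _ _ _ [set z | ideal_mul I J (z * a)]) => /=.
  + rewrite mul0r; exact: span0.
  + move=> k x y Xx Xy; rewrite mulrDl -scalerAl; exact: spanP.
  + move=> _ [x [y [Ix Jy ->]]] /=; apply: span_sub.
    exists x, (y * a); split; rewrite ?mulrA //; exact: idealMr.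
Qed.

Lemma ideal_mul_sub I J : is_ideal I -> is_ideal J ->
  ideal_mul I J `<=` I `&` J.
Proof.
move=> iI iJ; apply: span_min.
- by split; apply: ideal0.
- by move=> k x y [? ?] [? ?]; split; apply: idealZD.
- by move=> _ [x [y [? ? ->]]]; split; [apply: idealMr|apply: idealMl].
Qed.

Hypothesis primeA : prime_algebra A.

Lemma ideal_mul_neq0 I J : is_ideal I -> is_ideal J ->
  I <> [set 0] -> J <> [set 0] -> ideal_mul I J <> [set 0].
Proof.
move=> iI iJ I0 J0 IJ0; have [|//|//] := primeA iI iJ; move=> x y.
move=> Ix Jy; suff : ideal_mul I J (x * y) by rewrite IJ0.
by apply: span_sub; exists x, y.
Qed.

Lemma idealI_neq0 I J : is_ideal I -> is_ideal J ->
  I <> [set 0] -> J <> [set 0] -> I `&` J <> [set 0].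
Proof.
move=> iI iJ I0 J0; apply/(neq_set0P (idealI iI iJ)).
have /(neq_set0P (ideal_mulP iI iJ))[x IJx x0] := ideal_mul_neq0 iI iJ I0 J0.
by exists x => //; apply: ideal_mul_sub.
Qed.

End IdealTheory.

#[local] Obligation Tactic := idtac.

Section MartindaleRing.
Variables (K : fieldType) (A : algType K) (primeA : prime_algebra A).
Implicit Types f g h : partial_hom A.

Lemma phfun0 f : phfun f 0 = 0.
Proof.
by rewrite -[X in phfun f X](mulr0 0) phfunM ?mulr0 //; apply: ideal0;
  apply: phdom_ideal.
Qed.

Lemma phfunZ f (k : K) x : phdom f x -> phfun f (k *: x) = k *: phfun f x.
Proof. by move=> fx; rewrite -mulr_algr phfunM // mulr_algr. Qed.

Lemma ph_equiv_refl f : ph_equiv f f.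
Proof. by exists (phdom f); split; [case: f..|]. Qed.

Lemma ph_equiv_sym f g : ph_equiv f g -> ph_equiv g f.
Proof.
move=> [L [iL L0 Ls Le]]; exists L; split => //; first by rewrite setIC.
by move=> x /Le.
Qed.

Lemma ph_equiv_trans g f h : ph_equiv f g -> ph_equiv g h -> ph_equiv f h.
Proof.
move=> [L [iL L0 Ls Le]] [M [iM M0 Ms Me]]; exists (L `&` M); split.
- exact: idealI.
- exact: idealI_neq0.
- by move=> x [/Ls[? _] /Ms[_ ?]].
- by move=> x [/Le -> /Me].
Qed.

Definition ph_equivb : rel {classic partial_hom A} :=
  fun f g => `[< ph_equiv f g >].

Lemma ph_equivb_refl : reflexive ph_equivb.
Proof. by move=> f; apply/asboolP/ph_equiv_refl. Qed.

Lemma ph_equivb_sym : symmetric ph_equivb.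
Proof. by move=> f g; apply/asboolP/asboolP; apply: ph_equiv_sym. Qed.

Lemma ph_equivb_trans : transitive ph_equivb.
Proof.
by move=> g f h /asboolP fg /asboolP gh; apply/asboolP/(ph_equiv_trans fg).
Qed.

Canonical ph_equivb_equiv :=
  EquivRel ph_equivb ph_equivb_refl ph_equivb_sym ph_equivb_trans.

Definition martindale : Type := {eq_quot ph_equivb_equiv}.

HB.instance Definition _ := Choice.on martindale.
HB.instance Definition _ := EqQuotient.on martindale.

Lemma ph_piP f g :
  \pi_martindale f = \pi_martindale g <-> ph_equiv f g.
Proof.
split=> [fg|fg]; last by apply/eqmodP/asboolP.
by have /eqmodP/asboolP := fg.
Qed.

Program Definition ph_lmul (a : A) : partial_hom A :=
  @PartialHom _ A setT ( *%R a) _ _ _ _.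
Next Obligation. by move=> *; apply: idealT. Qed.
Next Obligation. by move=> *; apply: setT_neq0. Qed.
Next Obligation. by move=> a x y _ _; rewrite mulrDr. Qed.
Next Obligation. by move=> a x y _; rewrite mulrA. Qed.

Program Definition ph_add f g : partial_hom A :=
  @PartialHom _ A (phdom f `&` phdom g) (fun x => phfun f x + phfun g x)
    _ _ _ _.
Next Obligation. by move=> f g; apply: idealI; apply: phdom_ideal. Qed.
Next Obligation.
by move=> f g; apply: idealI_neq0 => //; (apply: phdom_ideal || apply: phdom_neq0).
Qed.
Next Obligation. by move=> f g x y [? ?] [? ?] /=; rewrite !phfunD // addrACA. Qed.
Next Obligation. by move=> f g x y [? ?] /=; rewrite !phfunM // mulrDl. Qed.

Program Definition ph_opp f : partial_hom A :=
  @PartialHom _ A (phdom f) (fun x => - phfun f x) _ _ _ _.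
Next Obligation. by move=> *; apply: phdom_ideal. Qed.
Next Obligation. by move=> *; apply: phdom_neq0. Qed.
Next Obligation. by move=> f x y ? ? /=; rewrite phfunD // opprD. Qed.
Next Obligation. by move=> f x y ? /=; rewrite phfunM // mulNr. Qed.

Lemma phfun_ideal_mul g (I : set A) : is_ideal I ->
  forall x, ideal_mul (phdom g) I x -> phdom g x /\ I (phfun g x).
Proof.
have ig := phdom_ideal g.
move=> iI; apply: span_min => [|k x y [gx Ix] [gy Iy]|_ [x [y [gx Iy ->]]]].
- by rewrite phfun0; split; apply: ideal0.
- have gkx : phdom g (k *: x) by rewrite -mulr_algl; apply: idealMl.
  by rewrite phfunD // phfunZ //; split; apply: idealZD.
- by rewrite phfunM //; split; [apply: idealMr|apply: idealMl].
Qed.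

Program Definition ph_mul f g : partial_hom A :=
  @PartialHom _ A (ideal_mul (phdom g) (phdom f)) (phfun f \o phfun g) _ _ _ _.
Next Obligation. by move=> f g; apply: ideal_mulP; apply: phdom_ideal. Qed.
Next Obligation.
by move=> f g; apply: ideal_mul_neq0 => //;
  (apply: phdom_ideal || apply: phdom_neq0).
Qed.
Next Obligation.
move=> f g x y.
move=> /(phfun_ideal_mul (phdom_ideal f))[gx fx].
move=> /(phfun_ideal_mul (phdom_ideal f))[gy fy].
by rewrite /= !phfunD.
Qed.
Next Obligation.
move=> f g x y /(phfun_ideal_mul (phdom_ideal f))[gx fx].
by rewrite /= !phfunM.
Qed.

(* Unlike in ph_equiv, L need not be contained in the domains: shrink L. *)
Lemma ph_equivI f g (L : set A) : is_ideal L -> L <> [set 0] ->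
  (forall x, L x -> phdom f x -> phdom g x -> phfun f x = phfun g x) ->
  ph_equiv f g.
Proof.
move=> iL L0 e; have [iF iG] := (phdom_ideal f, phdom_ideal g).
have [nF nG] := (@phdom_neq0 _ _ f, @phdom_neq0 _ _ g).
exists (L `&` (phdom f `&` phdom g)); split.
- by apply: idealI => //; apply: idealI.
- by apply: idealI_neq0 => //; [apply: idealI|apply: idealI_neq0].
- by move=> x [].
- by move=> x [? [? ?]]; apply: e.
Qed.

Lemma ph_equivT f g :
  (forall x, phdom f x -> phdom g x -> phfun f x = phfun g x) -> ph_equiv f g.
Proof.
move=> e; apply: (@ph_equivI _ _ setT) => [||x _]; last exact: e.
- exact: idealT.
- exact: setT_neq0.
Qed.

Lemma ph_add_equiv f f' g g' :
  ph_equiv f f' -> ph_equiv g g' -> ph_equiv (ph_add f g) (ph_add f' g').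
Proof.
move=> [L [iL L0 Ls Le]] [M [iM M0 Ms Me]].
apply: (@ph_equivI _ _ (L `&` M)).
- exact: idealI.
- exact: idealI_neq0.
- by move=> x [/Le /= -> /Me ->].
Qed.

Lemma ph_opp_equiv f f' : ph_equiv f f' -> ph_equiv (ph_opp f) (ph_opp f').
Proof.
by move=> [L [iL L0 Ls Le]]; apply: (@ph_equivI _ _ L) => // x /Le /= ->.
Qed.

Lemma ph_mul_equiv f f' g g' :
  ph_equiv f f' -> ph_equiv g g' -> ph_equiv (ph_mul f g) (ph_mul f' g').
Proof.
move=> [L [iL L0 Ls Le]] [M [iM M0 Ms Me]].
apply: (@ph_equivI _ _ (ideal_mul M L)).
- exact: ideal_mulP.
- exact: ideal_mul_neq0.
move=> x MLx _ _ /=.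
suff [Mx Lx] : M x /\ L (phfun g x) by rewrite -Me // Le.
move: x MLx.
apply: span_min => [|k x y [gx Ix] [gy Iy]|_ [x [y [gx Iy ->]]]].
- by rewrite phfun0; split; apply: ideal0.
- have Mkx : M (k *: x) by rewrite -mulr_algl; apply: idealMl.
  have [? _] := Ms _ Mkx; have [? _] := Ms _ gy; have [? _] := Ms _ gx.
  by rewrite phfunD // phfunZ //; split; apply: idealZD.
- have [? _] := Ms _ gx.
  by rewrite phfunM //; split; [apply: idealMr|apply: idealMl].
Qed.

Definition mlmul (a : A) : martindale := \pi_martindale (ph_lmul a).
Definition madd (p q : martindale) : martindale := \pi_martindale (ph_add (repr p) (repr q)).
Definition mopp (p : martindale) : martindale := \pi_martindale (ph_opp (repr p)).
Definition mmul (p q : martindale) : martindale := \pi_martindale (ph_mul (repr p) (repr q)).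

Lemma ph_repr f : ph_equiv (repr (\pi_martindale f)) f.
Proof. by apply/ph_piP; rewrite reprK. Qed.

Lemma maddE f g : madd (\pi_martindale f) (\pi_martindale g) = \pi_martindale (ph_add f g).
Proof. by apply/ph_piP/ph_add_equiv; apply: ph_repr. Qed.

Lemma moppE f : mopp (\pi_martindale f) = \pi_martindale (ph_opp f).
Proof. by apply/ph_piP/ph_opp_equiv/ph_repr. Qed.

Lemma mmulE f g : mmul (\pi_martindale f) (\pi_martindale g) = \pi_martindale (ph_mul f g).
Proof. by apply/ph_piP/ph_mul_equiv; apply: ph_repr. Qed.

Lemma mpiW (P : martindale -> Prop) : (forall f, P (\pi_martindale f)) -> forall p, P p.
Proof. by move=> Pf p; rewrite -[p]reprK. Qed.

Fact maddA : associative madd.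
Proof.
elim/mpiW=> f; elim/mpiW=> g; elim/mpiW=> h; rewrite !maddE; apply/ph_piP.
by apply: ph_equivT => x _ _ /=; rewrite addrA.
Qed.

Fact maddC : commutative madd.
Proof.
elim/mpiW=> f; elim/mpiW=> g; rewrite !maddE; apply/ph_piP.
by apply: ph_equivT => x _ _ /=; rewrite addrC.
Qed.

Fact madd0 : left_id (mlmul 0) madd.
Proof.
elim/mpiW=> f; rewrite !maddE; apply/ph_piP.
by apply: ph_equivT => x _ _ /=; rewrite mul0r add0r.
Qed.

Fact maddN : left_inverse (mlmul 0) mopp madd.
Proof.
elim/mpiW=> f; rewrite !moppE !maddE; apply/ph_piP.
by apply: ph_equivT => x _ _ /=; rewrite mul0r addNr.
Qed.

HB.instance Definition _ :=
  GRing.isZmodule.Build martindale maddA maddC madd0 maddN.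

Fact mmulA : associative mmul.
Proof.
elim/mpiW=> f; elim/mpiW=> g; elim/mpiW=> h; rewrite !mmulE; apply/ph_piP.
exact: ph_equivT.
Qed.

Fact mmul1l : left_id (mlmul 1) mmul.
Proof.
elim/mpiW=> f; rewrite !mmulE; apply/ph_piP.
by apply: ph_equivT => x _ _ /=; rewrite mul1r.
Qed.

Fact mmul1r : right_id (mlmul 1) mmul.
Proof.
elim/mpiW=> f; rewrite !mmulE; apply/ph_piP.
by apply: ph_equivT => x _ _ /=; rewrite mul1r.
Qed.

Fact mmulDl : left_distributive mmul madd.
Proof.
elim/mpiW=> f; elim/mpiW=> g; elim/mpiW=> h; rewrite !(maddE, mmulE).
by apply/ph_piP/ph_equivT.
Qed.

Fact mmulDr : right_distributive mmul madd.
Proof.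
elim/mpiW=> f; elim/mpiW=> g; elim/mpiW=> h; rewrite !(maddE, mmulE).
apply/ph_piP/ph_equivT => x _ [].
move=> /(phfun_ideal_mul (phdom_ideal f))[_ ?].
move=> /(phfun_ideal_mul (phdom_ideal f))[_ ?].
by rewrite /= phfunD.
Qed.

Lemma mlmul_inj : injective mlmul.
Proof.
move=> a b /ph_piP[L [iL L0 _ e]]; apply/eqP; rewrite -subr_eq0; apply/eqP.
pose I := [set z : A | forall x, L x -> z * x = 0].
have iI : is_ideal I.
  apply/idealP; split=> [x|x y Ix Iy z Lz|c x Ix z Lz|c x Ix z Lz] /=.
  - by rewrite mul0r.
  - by rewrite mulrBl Ix // Iy // subrr.
  - by rewrite -mulrA Ix // mulr0.
  - by rewrite -mulrA Ix //; apply: idealMl.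
have Iab : I (a - b).
  by move=> x Lx; rewrite mulrBl; apply/eqP; rewrite subr_eq0; apply/eqP/e.
have [|I0|//] := primeA iI iL; first by move=> x y; apply.
by move: Iab; rewrite I0.
Qed.

Fact mone_neq0 : mlmul 1 != 0.
Proof. by apply/eqP => /mlmul_inj/eqP; rewrite oner_eq0. Qed.

HB.instance Definition _ := GRing.Zmodule_isNzRing.Build martindale
  mmulA mmul1l mmul1r mmulDl mmulDr mone_neq0.

Fact mlmul_zmod_morphism : zmod_morphism mlmul.
Proof.
move=> a b; rewrite /GRing.opp /GRing.add /= moppE maddE.
by apply/ph_piP/ph_equivT => x _ _ /=; rewrite mulrBl.
Qed.

Fact mlmul_monoid_morphism : monoid_morphism mlmul.
Proof.
split=> // a b; rewrite /GRing.mul /= mmulE.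
by apply/ph_piP/ph_equivT => x _ _ /=; rewrite mulrA.
Qed.

HB.instance Definition _ :=
  GRing.isZmodMorphism.Build A martindale mlmul mlmul_zmod_morphism.
HB.instance Definition _ :=
  GRing.isMonoidMorphism.Build A martindale mlmul mlmul_monoid_morphism.

Definition extended_centre : set martindale :=
  [set z | forall q : martindale, z * q = q * z].

(* K is embedded in the extended centre through A. *)
Definition extended_centre_algebraic : Prop :=
  forall z : martindale, extended_centre z ->
    exists2 p : {poly K}, p != 0 & root (map_poly (mlmul \o in_alg A) p) z.

End MartindaleRing.

(* Main.v *)
From Pilot Require Import Defs.
From HB Require Import structures.
From mathcomp Require Import all_boot all_order all_algebra.
From mathcomp Require Import all_classical all_reals all_analysis.
From mathcomp Require Import perm zify.
From mathcomp Require Import -(notations) monalg.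
Import Pilot.Defs.

Set Implicit Arguments.
Unset Strict Implicit.
Unset Printing Implicit Defensive.

Import Order.TTheory GRing.Theory Num.Theory.

Local Open Scope classical_set_scope.
Local Open Scope quotient_scope.
Local Open Scope ring_scope.

(** Suppose that an element z of the extended centre C is transcendental over
    K.  The elements x of A such that z x lies in A form a nonzero ideal, hence
    one that is not locally nilpotent: it contains a finite-dimensional W with
    W^n <> 0 for all n.  Multiplication by z^i with i <= n keeps V^m W^n V^m
    inside A, in fact inside V^(O(m + n)), and the powers of z are independent
    over K.  So if V^(O(n)) W^n V^(O(n)) contains, up to a constant factor, n^2
    elements that are independent over C, then dim V^(O(n)) has order at least
    n^3 and the GK dimension is at least 3 ([cubic_growth],
    [cubic_growth_GK]).

    The quadratic bound ([quadratic_weight]) is about the algebra spanned by A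
    over the field C.  This algebra is prime and satisfies no standard identity.
    Call a word in a basis of W normal if its value is not a combination of the
    values of smaller words.  There are three cases ([growth_alternative]).

    - Every length n admits at least n + 1 normal words.  Those of lengths
      between n and 2 n are n^2 independent elements of W^n V^(O(n)).

    - The value a of some word is transcendental over C.  Consider the algebra
      as a right module over C[a].  If the rank of V^n is unbounded, n^2
      products b a^j with b in V^n are independent.  If it is bounded, then
      V^(m + n) q(a)^n lies in V^m C[a] for some m and some nonzero polynomial
      q; hence, up to denominators, the algebra acts on V^m C[a] through
      matrices over C[t] of a fixed size.  Matrices satisfy a standard identity
      and the algebra does not, so there is a g <> 0 for which
      g V^n q(a)^n p(a) = 0 with p nonzero and independent of n ([right_rank]).
      On the other side there is an h <> 0 of the same kind ([left_rank]).
      Therefore some multiple y of a^n in C[a], of degree O(n), satisfies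
      g V^n y = 0 = y V^n h; in a prime algebra this forces V^n y V^n to have
      dimension at least (n + 1)^2 ([annihilated_growth]).

    - The algebra generated by W has finite dimension.  Then some x <> 0 lies in
      W^n V^c for a constant c and all n.  If every V^n x is annihilated by some
      g <> 0 and every x V^n by some h <> 0, then V^n x V^n has dimension at
      least (n + 1)^2 as before.  Otherwise, say, no g <> 0 annihilates V^k x;
      then the dimensions of V^(n + k) x and of V^n differ at most by a constant
      factor, and the growth of V^n is quadratic by the two other cases applied
      to V, whose algebra has infinite dimension since A is not PI. *)

(** * Linear independence in spaces of arbitrary dimension *)

Section LinearAlgebra.
Variables (F : fieldType) (Q : lmodType F).
Implicit Types X Y : set Q.

Definition is_subspace X : Prop :=
  X 0 /\ forall a x y, X x -> X y -> X (a *: x + y).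

Lemma subspace_span X : is_subspace (span X).
Proof. by split; [apply: span0 | move=> a x y; apply: spanP]. Qed.

Lemma span_subspace X Y : is_subspace Y -> X `<=` Y -> span X `<=` Y.
Proof. by move=> [Y0 YD] XY; apply: span_min. Qed.

Lemma span_mono X Y : X `<=` Y -> span X `<=` span Y.
Proof.
by move=> XY; apply: span_subspace => [|x /XY]; [apply: subspace_span | apply: span_sub].
Qed.

Section Closure.
Variables (X : set Q) (sX : is_subspace X).

Lemma subspaceZ a x : X x -> X (a *: x).
Proof. by case: sX => X0 XD Xx; rewrite -[_ *: _]addr0; apply: XD. Qed.

Lemma subspaceD x y : X x -> X y -> X (x + y).
Proof. by case: sX => _ XD Xx Xy; rewrite -[x]scale1r; apply: XD. Qed.

Lemma subspaceN x : X x -> X (- x).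
Proof. by move=> Xx; rewrite -scaleN1r; apply: subspaceZ. Qed.

Lemma subspace_sum (I : Type) (r : seq I) (P : pred I) (f : I -> Q) :
  (forall i, P i -> X (f i)) -> X (\sum_(i <- r | P i) f i).
Proof.
by move=> Xf; apply: big_ind => // [|x y]; [case: sX | apply: subspaceD].
Qed.

End Closure.

Definition indep (I : finType) (b : I -> Q) : Prop :=
  forall c : I -> F, \sum_i c i *: b i = 0 -> forall i, c i = 0.

Definition has_indep X n : Prop :=
  exists2 b : 'I_n -> Q, lin_indep b & forall i, X (b i).

Lemma has_indep_sub X Y n : X `<=` Y -> has_indep X n -> has_indep Y n.
Proof. by move=> XY [b ib Xb]; exists b => // i; apply/XY/Xb. Qed.

Lemma indep_comp (I J : finType) (h : J -> I) (b : I -> Q) :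
  injective h -> indep b -> indep (b \o h).
Proof.
move=> hI ib c c0 j.
pose d i := \sum_(j | h j == i) c j.
have dE j' : d (h j') = c j'.
  by rewrite /d (big_pred1 j') // => k; rewrite /= (inj_eq hI).
rewrite -dE; apply: ib; rewrite -{2}c0 (partition_big h xpredT) //=.
apply: eq_bigr => i _; rewrite /d scaler_suml.
by apply: eq_bigr => k /eqP <-.
Qed.

Lemma indep_has_indep (I : finType) (b : I -> Q) X :
  indep b -> (forall i, X (b i)) -> has_indep X #|I|.
Proof.
move=> ib Xb; exists (b \o enum_val) => [|i]; last exact: Xb.
exact: (indep_comp (@enum_val_inj _ _)).
Qed.

(** Each member of the family escapes a subspace that holds all the members of
    smaller weight, so in a vanishing combination the heaviest coefficient
    vanishes. *)
Lemma triangular_indep (I : finType) (w : I -> nat) (Z : I -> set Q)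
    (b : I -> Q) :
  injective w -> (forall i, is_subspace (Z i)) ->
  (forall i j, (w j < w i)%N -> Z i (b j)) -> (forall i, ~ Z i (b i)) ->
  indep b.
Proof.
move=> wI sZ Zlt nZ c c0 i; apply/eqP/negPn/negP => ci.
have [k ck kmax] := @arg_maxnP I i (fun j => c j != 0) w ci.
apply: (nZ k); rewrite -[b k](scalerK ck).
apply: subspaceZ => //.
have -> : c k *: b k = - \sum_(j | j != k) c j *: b j.
  by apply/eqP; rewrite -addr_eq0; move: c0; rewrite (bigD1 k) //= => ->.
apply: subspaceN => //; apply: subspace_sum => // j jk.
have [->|cj] := eqVneq (c j) 0; first by rewrite scale0r; case: (sZ k).
apply: subspaceZ => //; apply: Zlt; rewrite ltn_neqAle; have /= -> := kmax j cj.
by rewrite andbT; apply: contraNneq jk => /wI ->.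
Qed.

Lemma span_rangeP n (b : 'I_n -> Q) x :
  span (range b) x <-> exists c : 'I_n -> F, x = \sum_i c i *: b i.
Proof.
split=> [|[c ->]]; last first.
  apply: (subspace_sum (subspace_span _)) => i _.
  by apply: (subspaceZ (subspace_span _)); apply: span_sub; exists i.
move: x; apply: span_subspace => [|_ [i _ <-]].
  split; first by exists (fun=> 0); rewrite big1 // => i _; rewrite scale0r.
  move=> a _ _ [c ->] [d ->]; exists (fun i => a * c i + d i).
  rewrite scaler_sumr -big_split /=; apply: eq_bigr => i _.
  by rewrite scalerDl scalerA.
exists (fun j => (j == i)%:R); rewrite (bigD1 i) //= eqxx scale1r big1 ?addr0 //.
by move=> j /negPf ->; rewrite scale0r.
Qed.

Lemma wide_kernel m n (M : 'M[F]_(n, m)) : (m < n)%N ->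
  exists2 c : 'I_n -> F, exists i, c i != 0 &
    forall j, \sum_i c i * M i j = 0.
Proof.
move=> mn; have rM : (\rank M <= m)%N by apply: rank_leq_col.
have : kermx M != 0.
  by rewrite -mxrank_eq0 mxrank_ker subn_eq0 -ltnNge (leq_ltn_trans rM).
move=> /matrix0Pn[k [i ki]]; exists (fun i => kermx M k i); first by exists i.
move=> j; have /matrixP/(_ k j) := mulmx_ker M.
by rewrite !mxE.
Qed.

(** More than n combinations of n vectors have a matrix of coefficients with a
    nonzero left kernel. *)
Lemma indep_leq X m n (v : 'I_n -> Q) :
  X `<=` span (range v) -> has_indep X m -> (m <= n)%N.
Proof.
move=> Xv [b ib Xb]; rewrite leqNgt; apply/negP => nm.
have /choice[M ME] : forall i, exists c : 'I_n -> F, b i = \sum_j c j *: v j.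
  move=> i; apply/span_rangeP; apply: Xv; exact: Xb.
have [c [i ci] cM] := wide_kernel (\matrix_(i, j) M i j) nm.
move/eqP: ci; apply; apply: ib.
under eq_bigr do rewrite ME scaler_sumr.
rewrite exchange_big big1 // => j _.
under eq_bigr do rewrite scalerA.
rewrite -scaler_suml (_ : \sum_i _ = 0) ?scale0r // -[RHS](cM j).
by apply: eq_bigr => k _; rewrite mxE.
Qed.

Lemma not_indep_extend X n (b : 'I_n -> Q) : lin_indep b ->
  (forall i, X (b i)) -> ~ has_indep X n.+1 -> X `<=` span (range b).
Proof.
move=> ib Xb nX x Xx; apply: contrapT => bx; apply: nX.
exists (fun i : 'I_n.+1 => if unlift ord_max i is Some j then b j else x);
  last by move=> i; case: unliftP => [j|] _.
move=> c; rewrite big_ord_recr /= unlift_none.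
under eq_bigr => i _.
  rewrite (_ : widen_ord _ i = lift ord_max i) ?liftK; last first.
    by apply/val_inj; rewrite /= /bump leqNgt ltn_ord.
  over.
move=> c0; have cx : c ord_max = 0.
  apply/eqP/negPn/negP => cx; apply: bx; rewrite -[x](scalerK cx).
  apply: (subspaceZ (subspace_span _)).
  have -> : c ord_max *: x = - \sum_(i < n) c (lift ord_max i) *: b i.
    by apply/eqP; rewrite -addr_eq0 addrC c0.
  apply: (subspaceN (subspace_span _)); apply/span_rangeP.
  by exists (fun i => c (lift ord_max i)).
move: c0; rewrite cx scale0r addr0 => /ib ci i.
by case: (unliftP ord_max i) => [j|] ->.
Qed.

Lemma has_indep0 X : has_indep X 0.
Proof. by exists (fun=> 0) => [c _ []|[]]. Qed.

(** The independent families in X have bounded sizes; one of maximal size cannot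
    be extended. *)
Lemma max_indep X N : ~ has_indep X N -> exists n (b : 'I_n -> Q),
  [/\ (n < N)%N, lin_indep b, forall i, X (b i) & X `<=` span (range b)].
Proof.
move=> nX; have ex : exists n, `[< ~ has_indep X n >] by exists N; apply/asboolP.
case: (ex_minnP ex) => [[/asboolP[]|n /asboolP nX' nmin]]; first exact: has_indep0.
have [b ib Xb] : has_indep X n.
  by apply: contrapT => /asboolP/nmin; rewrite ltnn.
by exists n, b; split=> //; [apply/nmin/asboolP | apply: not_indep_extend].
Qed.

Lemma has_indep_span X n : has_indep (span X) n -> has_indep X n.
Proof.
move=> iX; apply: contrapT => /max_indep[m [b [mn _ _ Xb]]].
have : span X `<=` span (range b).
  by apply: span_subspace => //; apply: subspace_span.
by move/indep_leq => /(_ _ iX); rewrite leqNgt mn.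
Qed.

Definition fin_gen X : Prop := exists n (v : 'I_n -> Q), X = span (range v).

Lemma fin_gen_subspace X : fin_gen X -> is_subspace X.
Proof. by move=> [n [v ->]]; apply: subspace_span. Qed.

Lemma fin_gen_basis X : fin_gen X -> exists n (b : 'I_n -> Q),
  [/\ lin_indep b, forall i, X (b i) & X = span (range b)].
Proof.
move=> [n [v XE]].
have [|m [b [_ ib Xb sXb]]] := @max_indep X n.+1.
  by rewrite XE => /(indep_leq (@subset_refl _ _)); rewrite ltnn.
exists m, b; split=> //; apply/seteqP; split=> //.
apply: span_subspace => [|_ [i _ <-] //]; rewrite XE; exact: subspace_span.
Qed.

End LinearAlgebra.

(** * Products of subspaces of an algebra *)

Section SubspaceProducts.
Variables (F : fieldType) (Q : algType F).
Implicit Types X Y Z : set Q.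

Local Notation "X ** Y" := (ideal_mul X Y) (at level 40, left associativity).

Lemma subspace_mul X Y : is_subspace (X ** Y).
Proof. exact: subspace_span. Qed.

Lemma mem_mul X Y x y : X x -> Y y -> (X ** Y) (x * y).
Proof. by move=> Xx Yy; apply: span_sub; exists x, y. Qed.

Lemma mul_sub X Y Z : is_subspace Z ->
  (forall x y, X x -> Y y -> Z (x * y)) -> X ** Y `<=` Z.
Proof.
by move=> sZ XYZ; apply: span_subspace => // _ [x [y [Xx Yy ->]]]; apply: XYZ.
Qed.

Lemma subspace_lmul a Z : is_subspace Z -> is_subspace [set t | Z (a * t)].
Proof.
move=> [Z0 ZD]; split=> [|k x y Zx Zy] /=; first by rewrite mulr0.
by rewrite mulrDr -scalerAr; apply: ZD.
Qed.

Lemma subspace_rmul a Z : is_subspace Z -> is_subspace [set t | Z (t * a)].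
Proof.
move=> [Z0 ZD]; split=> [|k x y Zx Zy] /=; first by rewrite mul0r.
by rewrite mulrDl -scalerAl; apply: ZD.
Qed.

Lemma subspace0 : is_subspace [set 0 : Q].
Proof. by split=> // a x y /= -> ->; rewrite scaler0 addr0. Qed.

Lemma mul_mono X X' Y Y' : X `<=` X' -> Y `<=` Y' -> X ** Y `<=` X' ** Y'.
Proof.
move=> XX YY; apply: mul_sub => [|x y /XX Xx /YY]; first exact: subspace_mul.
exact: mem_mul.
Qed.

Lemma mulspA X Y Z : X ** Y ** Z = X ** (Y ** Z).
Proof.
apply/seteqP; split; apply: mul_sub; do ?exact: subspace_mul.
  move=> t z + Zz; move: t; apply: mul_sub.
    exact/(subspace_rmul z)/subspace_mul.
  by move=> x y Xx Yy /=; rewrite -mulrA; do !apply: mem_mul.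
move=> x t Xx; move: t; apply: mul_sub; first exact/(subspace_lmul x)/subspace_mul.
by move=> y z Yy Zz /=; rewrite mulrA; do !apply: mem_mul.
Qed.

Lemma mul1sp X : is_subspace X -> span [set 1] ** X = X.
Proof.
move=> sX; apply/seteqP; split=> [|x Xx].
  apply: mul_sub => // t x + Xx; move: t; apply: span_subspace => [|_ ->].
    exact: (subspace_rmul x sX).
  by rewrite /= mul1r.
by rewrite -[x]mul1r; apply: mem_mul => //; apply: span_sub.
Qed.

Lemma mulsp1 X : is_subspace X -> X ** span [set 1] = X.
Proof.
move=> sX; apply/seteqP; split=> [|x Xx].
  apply: mul_sub => // x t Xx; move: t; apply: span_subspace => [|_ ->].
    exact: (subspace_lmul x sX).
  by rewrite /= mulr1.
by rewrite -[x]mulr1; apply: mem_mul => //; apply: span_sub.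
Qed.

Fixpoint spow X n : set Q := if n is m.+1 then X ** spow X m else span [set 1].

Lemma subspace_spow X n : is_subspace (spow X n).
Proof. by case: n => [|n]; apply: subspace_span. Qed.

Lemma spowD X m n : spow X (m + n) = spow X m ** spow X n.
Proof.
elim: m => [|m IH]; first by rewrite mul1sp //; apply: subspace_spow.
by rewrite addSn /= IH mulspA.
Qed.

Lemma spow1 X : is_subspace X -> spow X 1 = X.
Proof. exact: mulsp1. Qed.

Lemma spowSr X n : is_subspace X -> spow X n.+1 = spow X n ** X.
Proof. by move=> sX; rewrite -addn1 spowD spow1. Qed.

Lemma spow_mono X Y n : X `<=` Y -> spow X n `<=` spow Y n.
Proof. by move=> XY; elim: n => //= n; apply: mul_mono. Qed.

Lemma spow_leq X m n : X 1 -> (m <= n)%N -> spow X m `<=` spow X n.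
Proof.
move=> X1 /subnK <-; elim: (n - m)%N => // k IH x /IH Xx.
by rewrite addSn /= -[x]mul1r; apply: mem_mul.
Qed.

Lemma spowM X m n : spow (spow X m) n = spow X (m * n).
Proof. by elim: n => [|n IH]; rewrite ?muln0 // mulnS spowD /= IH. Qed.

Lemma spow_exp X x n : X x -> spow X n (x ^+ n).
Proof.
move=> Xx; elim: n => [|n IH]; first exact: span_sub.
by rewrite exprS; apply: mem_mul.
Qed.

Lemma fin_gen_mul X Y : fin_gen X -> fin_gen Y -> fin_gen (X ** Y).
Proof.
move=> [m [u XE]] [n [v YE]]; exists #|{: 'I_m * 'I_n}|.
exists (fun k => u (enum_val k).1 * v (enum_val k).2).
apply/seteqP; split; last first.
  apply: span_mono => _ [k _ <-]; eexists; eexists; split; last reflexivity.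
    by rewrite XE; apply: span_sub; eexists.
  by rewrite YE; apply: span_sub; eexists.
rewrite XE YE; apply: mul_sub => [|x y + Yy]; first exact: subspace_span.
move: x; apply: span_subspace; first exact/(subspace_rmul y)/subspace_span.
move=> _ [i _ <-] /=; move: y Yy; apply: span_subspace.
  exact/(subspace_lmul (u i))/subspace_span.
move=> _ [j _ <-] /=; apply: span_sub; exists (enum_rank (i, j)) => //.
by rewrite enum_rankK.
Qed.

Lemma fin_gen_spow X n : fin_gen X -> fin_gen (spow X n).
Proof.
move=> gX; elim: n => [|n IH] /=; last exact: fin_gen_mul.
exists 1, (fun=> 1); congr span; apply/seteqP; split=> [_ ->|_ [_ _ <-]//].
by exists ord0.
Qed.

Lemma space_expE X n : space_exp X n = spow X n.
Proof.
elim: n => [|n IH] /=.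
  congr span; apply/seteqP; split=> [_ [x _ <-]|_ ->]; first by rewrite big_ord0.
  by exists (fun=> 1) => [[]//|]; rewrite big_ord0.
rewrite -IH; apply/seteqP; split.
  apply: span_subspace => [|_ [x Xx <-]]; first exact: subspace_mul.
  rewrite big_ord_recl; apply: mem_mul => //; apply: span_sub.
  by exists (fun i => x (lift ord0 i)) => // i; apply: Xx.
apply: mul_sub => [|x t Xx]; first exact: subspace_span.
move: t; apply: span_subspace; first exact/(subspace_lmul x)/subspace_span.
move=> _ [y Xy <-]; apply: span_sub.
exists (fun i => if unlift ord0 i is Some j then y j else x).
  by move=> i; case: unliftP.
by rewrite big_ord_recl unlift_none; under eq_bigr do rewrite liftK.
Qed.

End SubspaceProducts.

Notation "X ** Y" := (ideal_mul X Y) (at level 40, left associativity).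

(** * Normal words and the growth of a finitely generated algebra *)

Section Transcendental.
Variables (F : fieldType) (Q : algType F).

Definition transcendental (a : Q) : Prop :=
  forall p : {poly F}, horner_alg a p = 0 -> p = 0.

Lemma horner_algE (a : Q) (p : {poly F}) :
  horner_alg a p = \sum_(i < size p) p`_i *: a ^+ i.
Proof.
rewrite -[p in LHS]coefK poly_def linear_sum; apply: eq_bigr => i _.
by rewrite linearZ /= mulr_algl rmorphXn /= horner_algX.
Qed.

End Transcendental.

Lemma uniq_map_inj (T1 T2 : eqType) (f : T1 -> T2) (s : seq T1) :
  uniq (map f s) -> {in s &, injective f}.
Proof.
elim: s => //= a s IH /andP[/negP fa us] x y.
rewrite !inE => /predU1P[->|xs] /predU1P[->|ys] // e; last exact: IH.
  by case: fa; rewrite e map_f.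
by case: fa; rewrite -e map_f.
Qed.

Lemma mkseqD T (f : nat -> T) m n :
  mkseq f (m + n) = mkseq f m ++ mkseq (fun i => f (m + i)%N) n.
Proof. by rewrite /mkseq iotaD map_cat add0n -[in X in _ ++ X](addn0 m) iotaDl -map_comp. Qed.

Lemma pigeonhole (T : finType) (f : nat -> T) :
  exists i j, (i < j)%N /\ f i = f j.
Proof.
apply: contrapT => nf.
have fI : injective (fun i : 'I_#|T|.+1 => f i).
  move=> i j e; apply: contrapT => ij; apply: nf.
  case: (ltngtP i j) => [ltij|ltji|/val_inj//]; first by exists i, j.
  by exists j, i.
by have := leq_card _ fI; rewrite card_ord ltnn.
Qed.

Section Words.
Variables (F : fieldType) (Q : algType F) (d : nat) (u : 'I_d -> Q).
Implicit Types w v : seq 'I_d.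

Definition wval w : Q := \prod_(i <- w) u i.

Lemma wval_cat w v : wval (w ++ v) = wval w * wval v.
Proof. exact: big_cat. Qed.

(** The digits run from 1 to d in base d + 1, so comparing ranks compares
    lengths first and then the words lexicographically. *)
Fixpoint word_rank w : nat :=
  if w is x :: v then (x.+1 * d.+1 ^ size v + word_rank v)%N else 0%N.

Lemma rank_cat w v : word_rank (w ++ v) = (word_rank w * d.+1 ^ size v + word_rank v)%N.
Proof.
elim: w => //= x w ->; rewrite size_cat expnD mulnDl addnA; congr (_ + _ + _)%N.
by rewrite mulnA.
Qed.

Lemma rank_lt w : (word_rank w < d.+1 ^ size w)%N.
Proof.
elim: w => //= x w IH; rewrite expnS; apply: (@leq_trans (x.+1 * d.+1 ^ size w + d.+1 ^ size w)).
  by rewrite -addnS leq_add2l.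
by rewrite addnC -mulSn leq_mul2r ltnS ltn_ord orbT.
Qed.

Lemma size_lt_rank w v : (size w < size v)%N -> (word_rank w < word_rank v)%N.
Proof.
case: v => //= x v; rewrite ltnS => wv; apply: leq_trans (rank_lt w) _.
apply: leq_trans (leq_addr _ _); rewrite mulSn; apply: leq_trans (leq_addr _ _).
exact: leq_pexp2l.
Qed.

Lemma rank_inj : injective word_rank.
Proof.
move=> w v wv; have sz : size w = size v.
  by case: (ltngtP (size w) (size v)) => // /size_lt_rank; rewrite wv ltnn.
elim: w v sz wv => [|x w IH] [|y v] //= [sz].
rewrite sz => e; have lw : (word_rank w < d.+1 ^ size v)%N by rewrite -sz rank_lt.
have /= := congr1 (fun k => k %/ d.+1 ^ size v)%N e.
have /= := congr1 (fun k => k %% d.+1 ^ size v)%N e.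
rewrite !modnMDl !divnMDl ?expn_gt0 // !modn_small ?rank_lt //.
rewrite !divn_small ?rank_lt // !addn0 => /(IH _ sz) -> [] xy.
by rewrite (val_inj xy : x = y).
Qed.

Lemma rank_factor p w v s : (word_rank w < word_rank v)%N ->
  (word_rank (p ++ w ++ s) < word_rank (p ++ v ++ s))%N.
Proof.
move=> wv; have sz : (size w <= size v)%N.
  by rewrite leqNgt; apply/negP => /size_lt_rank; rewrite ltnNge ltnW.
rewrite !rank_cat !size_cat -addnS leq_add //.
  by rewrite leq_mul2l leq_pexp2l ?orbT // leq_add2r.
by rewrite ltn_add2r ltn_mul2r expn_gt0.
Qed.

Definition normal_word w : Prop :=
  ~ span (wval @` [set v | (word_rank v < word_rank w)%N]) (wval w).

(** Multiplication by p and s preserves the order of words, so a relation that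
    expresses w by smaller words expresses p w s by smaller words. *)
Lemma normal_factor p w s : normal_word (p ++ w ++ s) -> normal_word w.
Proof.
move=> npws sw; apply: npws; rewrite !wval_cat mulrA.
set Z := span _; have sZ : is_subspace Z by apply: subspace_span.
pose Z' := [set t | Z (wval p * t * wval s)].
have sZ' : is_subspace Z' by exact: (subspace_lmul (wval p) (subspace_rmul (wval s) sZ)).
suff : Z' (wval w) by [].
move: (wval w) sw; apply: span_subspace => // _ [v vw <-]; apply: span_sub.
exists (p ++ v ++ s); first exact: rank_factor.
by rewrite !wval_cat mulrA.
Qed.

Lemma normal_indep (I : finType) (h : I -> seq 'I_d) :
  injective h -> (forall i, normal_word (h i)) -> indep (wval \o h).
Proof.
move=> hI nh; apply: (@triangular_indep _ _ _ (word_rank \o h)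
  (fun i => span (wval @` [set v | (word_rank v < word_rank (h i))%N]))) => //.
- by move=> i j /rank_inj/hI.
- by move=> i; apply: subspace_span.
- by move=> i j ji; apply: span_sub; exists (h j).
Qed.

Lemma wval_span w :
  span (wval @` [set v | normal_word v /\ (word_rank v <= word_rank w)%N]) (wval w).
Proof.
have [n] := ubnP (word_rank w); elim: n w => // n IH w; rewrite ltnS => wn.
have [nw|/contrapT sw] := pselect (normal_word w); first by apply: span_sub; exists w.
move: (wval w) sw; apply: span_subspace => [|_ [v /= vw <-]].
  exact: subspace_span.
apply: (span_mono _ (IH v (leq_trans vw wn))) => _ [v' [nv' v'v] <-].
by exists v' => //; split=> //; apply: leq_trans v'v (ltnW vw).
Qed.

(** Normal words are shorter than L, since a longer one would have a normal prefix
    of length L; and they span. *)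
Lemma wval_bounded L : (forall w, normal_word w -> size w <> L) ->
  forall w, span (wval @` [set v | (size v < L)%N]) (wval w).
Proof.
move=> nL w; apply: (span_mono _ (@wval_span w)) => _ [v [nv _] <-]; exists v => //=.
rewrite ltnNge; apply/negP => Lv; apply: (nL (take L v)); last by rewrite size_takel.
by apply: (@normal_factor [::] _ (drop L v)); rewrite /= cat_take_drop.
Qed.

(** A polynomial relation would express the highest power of w that occurs in it
    by lower powers, which are shorter words. *)
Lemma periodic_transcendental w : w <> [::] ->
  (forall m, normal_word (flatten (nseq m w))) -> transcendental (wval w).
Proof.
move=> w0 nw p p0; apply: contrapT => /eqP pn0.
have wX m : wval (flatten (nseq m w)) = wval w ^+ m.
  by elim: m => [|m IH] /=; rewrite ?[wval _]big_nil // wval_cat IH exprS.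
have sX m : size (flatten (nseq m w)) = (m * size w)%N.
  by elim: m => //= m IH; rewrite size_cat IH.
have [m sp] : {m | size p = m.+1}.
  by exists (size p).-1; rewrite prednK // lt0n size_poly_eq0.
apply: (nw m); rewrite wX; set Z := span _.
have sZ : is_subspace Z by apply: subspace_span.
have pm : p`_m != 0 by rewrite -[m]/(m.+1.-1) -sp -lead_coefE lead_coef_eq0.
rewrite -[_ ^+ m](scalerK pm); apply: (subspaceZ sZ).
move: p0; rewrite horner_algE sp big_ord_recr /= => /eqP; rewrite addrC addr_eq0 => /eqP ->.
apply: (subspaceN sZ); apply: (subspace_sum sZ) => i _; apply: (subspaceZ sZ).
apply: span_sub; exists (flatten (nseq i w)); last exact: wX.
by apply: size_lt_rank; rewrite !sX ltn_mul2r ltn_ord andbT; case: (w) w0.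
Qed.

(** Unlike normal words, extendable ones have no dead ends, so their number cannot
    drop when the length grows. *)
Definition extendable w : Prop :=
  forall m, exists v, size v = m /\ normal_word (w ++ v).

Lemma extendable_normal w : extendable w -> normal_word w.
Proof. by move=> e; have [v [/size0nil ->]] := e 0%N; rewrite cats0. Qed.

Lemma extendable_factor p w s : extendable (p ++ w ++ s) -> extendable w.
Proof.
move=> e m; have [v [sv nv]] := e m; exists (take m (s ++ v)).
rewrite size_takel ?size_cat ?sv ?leq_addl //; split=> //.
apply: (@normal_factor p _ (drop m (s ++ v))).
by rewrite -[(w ++ _) ++ _]catA cat_take_drop; rewrite -!catA in nv.
Qed.

(** If no letter x could be followed by words of length f x, then w could not be
    followed by words of length 1 + max f. *)
Lemma extendable_rcons w : extendable w -> exists x, extendable (rcons w x).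
Proof.
move=> e; apply: contrapT => nx.
have /choice[f fP] : forall x : 'I_d, exists m, forall v, size v = m ->
    ~ normal_word (rcons w x ++ v).
  move=> x; apply: contrapT => nf; apply: nx; exists x => m.
  by apply: contrapT => nv; apply: nf; exists m => v sv nv'; apply: nv; exists v.
have [v0 [sv nv]] := e (\max_(x < d) f x).+1; case: v0 sv nv => // x v [sv] nv.
have fx : (f x <= size v)%N by rewrite sv; apply: leq_bigmax.
apply: (fP x (take (f x) v)); first by rewrite size_takel.
apply: (@normal_factor [::] _ (drop (f x) v)).
by rewrite /= -catA cat_take_drop cat_rcons.
Qed.

Definition extendables n : seq (seq 'I_d) :=
  [seq w <- map val (enum {: n.-tuple 'I_d}) | `[< extendable w >]].

Lemma mem_extendables n w :
  (w \in extendables n) = (size w == n) && `[< extendable w >].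
Proof.
rewrite mem_filter andbC; congr andb; apply/mapP/eqP => [[t _ ->]|sw].
  by rewrite size_tuple.
by subst n; exists (in_tuple w); rewrite ?mem_enum.
Qed.

Lemma extendables_uniq n : uniq (extendables n).
Proof. by rewrite filter_uniq // map_inj_uniq ?enum_uniq //; apply: val_inj. Qed.

Lemma extendables_ltn n : (forall w, w <> [::] -> ~ transcendental (wval w)) ->
  extendable [::] -> (size (extendables n) < size (extendables n.+1))%N.
Proof.
move=> nT e0.
have sub : {subset extendables n <= map (take n) (extendables n.+1)}.
  move=> w; rewrite mem_extendables => /andP[/eqP sw /asboolP/extendable_rcons[x ex]].
  apply/mapP; exists (rcons w x); last by rewrite -cats1 take_size_cat.
  by rewrite mem_extendables size_rcons sw eqxx; apply/asboolP.
rewrite ltnNge; apply/negP => le.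
have tI : {in extendables n.+1 &, injective (take n)}.
  apply: uniq_map_inj; apply: (leq_size_uniq (extendables_uniq n) sub).
  by rewrite size_map.
(* If there are no more extendable words of length n + 1 than of length n, the
   last n letters of an extendable word determine the next one; a right-infinite
   extendable word is then eventually periodic. *)
have nextI w x y : size w = n -> extendable (rcons w x) ->
    extendable (rcons w y) -> x = y.
  move=> sw ex ey; have /tI : take n (rcons w x) = take n (rcons w y).
    by rewrite -!cats1 !take_size_cat.
  rewrite !mem_extendables !size_rcons sw eqxx /= => e.
  by have /rcons_inj[] := e (asboolT ex) (asboolT ey).
have [x0 _] := extendable_rcons e0.
have /choice[next nextP] : forall w, exists x, extendable w -> extendable (rcons w x).
  move=> w; have [/extendable_rcons[x ex]|ne] := pselect (extendable w).
    by exists x.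
  by exists x0.
pose W := fix W k := if k is k'.+1 then rcons (W k') (next (W k')) else [::].
pose x k := next (W k).
have WE k : W k = mkseq x k by elim: k => // k IH; rewrite mkseqS -IH.
have xE a b : extendable (mkseq (fun i => x (a + i)%N) b).
  have : extendable (W (a + b)%N) by elim: (a + b)%N => //= k; apply: nextP.
  rewrite WE mkseqD => e; apply: (@extendable_factor (mkseq x a) _ [::]).
  by rewrite cats0.
have [i [j [ij sij]]] := pigeonhole (fun k => [tuple x (k + t)%N | t < n]).
have xij t : x (i + t)%N = x (j + t)%N.
  have [tn|nt] := ltnP t n.
    by have := congr1 (fun s => tnth s (Ordinal tn)) sij; rewrite !tnth_mktuple.
  have [m] := ubnP t; elim: m t nt => // m IH t nt; rewrite ltnS => tm.
  have e k : rcons (mkseq (fun r => x (k + (t - n) + r)%N) n) (x (k + t)%N) =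
      mkseq (fun r => x (k + (t - n) + r)%N) n.+1.
    by rewrite mkseqS -addnA subnK.
  apply: (nextI (mkseq (fun r => x (i + (t - n) + r)%N) n)).
  - by rewrite size_mkseq.
  - by rewrite e; apply: xE.
  rewrite (_ : mkseq _ n = mkseq (fun r => x (j + (t - n) + r)%N) n); last first.
    apply: (@eq_from_nth _ x0); rewrite !size_mkseq // => r rn.
    rewrite !nth_mkseq // -!addnA.
    have [tn|] := ltnP (t - n + r) n.
      by have := congr1 (fun s => tnth s (Ordinal tn)) sij; rewrite !tnth_mktuple.
    by move=> ntr; apply: IH => //; lia.
  by rewrite e; apply: xE.
pose p := (j - i)%N; pose f t := x (i + t)%N.
have fp t : f (p + t)%N = f t by rewrite /f addnA subnKC ?xij // ltnW.
have fm m : mkseq f (m * p) = flatten (nseq m (mkseq f p)).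
  elim: m => //= m IH; rewrite mulSn mkseqD; congr cat.
  by rewrite -IH; apply: eq_mkseq => t; apply: fp.
apply: (nT (mkseq f p)).
  by move=> /(congr1 size)/eqP; rewrite size_mkseq subn_eq0 leqNgt ij.
apply: periodic_transcendental => [/(congr1 size)/eqP|m].
  by rewrite size_mkseq subn_eq0 leqNgt ij.
by rewrite -fm; apply/extendable_normal/xE.
Qed.

Lemma normal_words_count : (forall n, exists w, normal_word w /\ size w = n) ->
  (exists w, w <> [::] /\ transcendental (wval w)) \/
  forall n, exists h : 'I_n.+1 -> seq 'I_d,
    injective h /\ forall i, normal_word (h i) /\ size (h i) = n.
Proof.
move=> nw; have e0 : extendable [::] by move=> m; have [w []] := nw m; exists w.
have [[w]|nT] := pselect (exists w, w <> [::] /\ transcendental (wval w)).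
  by left; exists w.
right=> n; have sz : (n < size (extendables n))%N.
  elim: n => [|n IH].
    rewrite lt0n size_eq0; apply/eqP => e.
    by have := mem_extendables 0 [::]; rewrite e eqxx asboolT.
  apply: leq_ltn_trans IH (extendables_ltn n _ e0) => w w0 tw.
  by apply: nT; exists w.
exists (fun i : 'I_n.+1 => nth [::] (extendables n) i); split=> [i j e|i].
  have ltz (k : 'I_n.+1) : (k < size (extendables n))%N by apply: leq_trans sz.
  by apply/val_inj/eqP; rewrite /= -(nth_uniq [::] (ltz i) (ltz j) (extendables_uniq n)) e.
have : nth [::] (extendables n) i \in extendables n.
  by rewrite mem_nth // (leq_trans (ltn_ord i)).
by rewrite mem_extendables => /andP[/eqP ? /asboolP/extendable_normal].
Qed.

End Words.

Section GrowthAlternative.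
Variables (F : fieldType) (Q : algType F).
Implicit Types W : set Q.

Lemma wval_spow d (u : 'I_d -> Q) w : spow (span (range u)) (size w) (wval u w).
Proof.
elim: w => [|x w IH]; first by rewrite /wval big_nil; apply: span_sub.
rewrite /wval big_cons; apply: mem_mul => //; apply: span_sub; by exists x.
Qed.

Lemma spow_range d (u : 'I_d -> Q) n :
  spow (span (range u)) n `<=` span (wval u @` [set w | size w = n]).
Proof.
elim: n => [|n IH] /=.
  by apply: span_mono => _ ->; exists [::]; rewrite // /wval big_nil.
apply: mul_sub => [|x y]; first exact: subspace_span.
move=> + /IH; set Z := span (_ @` [set w | size w = n.+1]) => Wx.
have sZ : is_subspace Z by apply: subspace_span.
move: y; apply: span_subspace; first exact: (subspace_lmul x sZ).
move=> _ [w /= sw <-]; move: x Wx; apply: span_subspace.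
  exact: (subspace_rmul _ sZ).
move=> _ [i _ <-] /=; apply: span_sub; exists (i :: w); rewrite /= ?sw //.
by rewrite /wval big_cons.
Qed.

(** For a finitely generated W: the algebra generated by W has finite
    dimension. *)
Definition finite_powers W : Prop :=
  exists L, forall n, spow W n `<=` span [set x | exists l, (l < L)%N /\ spow W l x].

Lemma growth_alternative W : fin_gen W ->
  [\/ finite_powers W,
      exists k a, [/\ (0 < k)%N, spow W k a & transcendental a]
    | forall n, has_indep [set x | exists l, [/\ (n <= l)%N, (l <= n + n)%N
                                             & spow W l x]] (n.+1 ^ 2)].
Proof.
move=> [d [u ->]].
have [nw|] := pselect (forall n, exists w, normal_word u w /\ size w = n); last first.
  move=> /existsNP[L nL]; constructor 1; exists L => n x /spow_range.
  move: x; apply: span_subspace => [|_ [w _ <-]]; first exact: subspace_span.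
  have : forall w, normal_word u w -> size w <> L by move=> v nv sv; apply: nL; exists v.
  move=> /wval_bounded/(_ w); apply: span_mono => _ [v vL <-].
  by exists (size v); split=> //; apply: wval_spow.
have [[w [w0 tw]]|H] := normal_words_count nw.
  constructor 2; exists (size w), (wval u w); split=> //; last exact: wval_spow.
  by case: (w) w0.
constructor 3 => n.
(* Take n + 1 normal words of each of the n + 1 lengths n, ..., 2 n. *)
have /choice[h hP] : forall l : 'I_n.+1, exists h : 'I_n.+1 -> seq 'I_d,
    injective h /\ forall i, normal_word u (h i) /\ size (h i) = (n + l)%N.
  move=> l; have [h [hI hN]] := H (n + l)%N.
  exists (h \o widen_ord (leq_addr l n : (n < (n + l).+1)%N)); split=> [i j /hI|i].
    by move=> /(congr1 val) ij; apply: val_inj.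
  exact: hN.
have -> : (n.+1 ^ 2 = #|{: 'I_n.+1 * 'I_n.+1}|)%N by rewrite card_prod card_ord.
apply: (@indep_has_indep _ _ _ (fun li => wval u (h li.1 li.2))).
  apply: (@normal_indep _ _ _ _ _ (fun li => h li.1 li.2)); last first.
    by move=> [l i]; have [_ /(_ i)[]] := hP l.
  move=> [l i] [l' i'] /= e; have [hI hN] := hP l; have [_ hN'] := hP l'.
  have ll : l = l'.
    have := congr1 size e; rewrite (hN _).2 (hN' _).2 => /addnI ll.
    exact: val_inj.
  by subst l'; rewrite (hI _ _ e).
move=> [l i] /=; have [_ /(_ i)[_ sz]] := hP l; exists (n + l)%N.
by rewrite leq_addr leq_add2l -ltnS ltn_ord -sz; split=> //; apply: wval_spow.
Qed.

End GrowthAlternative.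

(** * Standard identities *)

Section StandardPolynomial.

Definition standard_poly (R : nzRingType) N (x : 'I_N -> R) : R :=
  \sum_(s : 'S_N) (-1) ^+ s * \prod_(i < N) x (s i).

Lemma standard_rmorph (R S : nzRingType) (f : {rmorphism R -> S}) N
    (x : 'I_N -> R) : f (standard_poly x) = standard_poly (f \o x).
Proof.
rewrite /standard_poly rmorph_sum; apply: eq_bigr => s _.
by rewrite rmorphM rmorph_sign rmorph_prod.
Qed.

(** Composition with the transposition of i and j pairs the even permutations
    with the odd ones. *)
Lemma standard_alternating (R : nzRingType) N (x : 'I_N -> R) i j :
  i != j -> x i = x j -> standard_poly x = 0.
Proof.
move=> ij xij; pose t := tperm i j.
have xt k : x (t k) = x k by rewrite /t; case: tpermP => [->|->|].
rewrite /standard_poly (bigID (fun s : 'S_N => odd_perm s)) /= addrC.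
apply/eqP; rewrite addr_eq0; apply/eqP; rewrite -sumrN (reindex_inj (mulIg t)) /=.
apply: eq_big => s; rewrite odd_permM odd_tperm ij addbT ?negbK // => os.
rewrite os expr0 expr1 mul1r mulN1r opprK.
by apply: eq_bigr => k _; rewrite permM xt.
Qed.

Definition update (I : eqType) T (x : I -> T) i y : I -> T :=
  fun k => if k == i then y else x k.

Section Multilinear.
Variables (F : fieldType) (Q : algType F).

Lemma prod_update_linear (I : eqType) (r : seq I) (x : I -> Q) i a y z :
  uniq r -> i \in r -> \prod_(k <- r) update x i (a *: y + z) k =
  a *: \prod_(k <- r) update x i y k + \prod_(k <- r) update x i z k.
Proof.
elim: r => //= k r IH /andP[kr ur]; rewrite inE !big_cons => /predU1P[ik|ir].
  have e y' : \prod_(j <- r) update x i y' j = \prod_(j <- r) x j.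
    rewrite big_seq [RHS]big_seq; apply: eq_bigr => j jr; rewrite /update.
    by case: eqP => // ji; rewrite -ik -ji jr in kr.
  by rewrite !e /update ik eqxx mulrDl scalerAl.
have ux y' : update x i y' k = x k.
  by rewrite /update; case: eqP => // ki; rewrite ki ir in kr.
by rewrite IH // !ux mulrDr scalerAr.
Qed.

Lemma standard_update_linear N (x : 'I_N -> Q) i a y z :
  standard_poly (update x i (a *: y + z)) =
  a *: standard_poly (update x i y) + standard_poly (update x i z).
Proof.
rewrite /standard_poly scaler_sumr -big_split; apply: eq_bigr => s _ /=.
have e (w : 'I_N -> Q) : \prod_(k < N) w (s k) = \prod_(k <- map s (enum 'I_N)) w k.
  by rewrite big_map enumT.
rewrite !e prod_update_linear ?mulrDr ?scalerAr //.
  by rewrite map_inj_uniq ?enum_uniq //; apply: perm_inj.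
by rewrite -[i](permKV s) map_f // mem_enum.
Qed.

Lemma standard_dependent N (x : 'I_N -> Q) (c : 'I_N -> F) i :
  \sum_k c k *: x k = 0 -> c i != 0 -> standard_poly x = 0.
Proof.
move=> cx ci; pose L y := standard_poly (update x i y).
have L0 : L 0 = 0.
  by have := standard_update_linear x i (-1) 0 0; rewrite scaler0 addr0 scaleN1r addNr.
have LD y z : L (y + z) = L y + L z.
  by rewrite -[y in LHS]scale1r /L standard_update_linear scale1r.
have LZ a y : L (a *: y) = a *: L y.
  by rewrite -[_ *: _ in LHS]addr0 /L standard_update_linear -/(L 0) L0 addr0.
have Lx k : k != i -> L (x k) = 0.
  move=> ki; apply: (@standard_alternating _ _ _ i k); first by rewrite eq_sym.
  by rewrite /update eqxx (negPf ki).
have -> : x = update x i (x i).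
  by apply/funext => k; rewrite /update; case: eqP => // ->.
rewrite -/(L _) -[L _](scalerK ci) -LZ.
move: cx; rewrite (bigD1 i) //= => /eqP; rewrite addr_eq0 => /eqP ->.
rewrite -scaleN1r LZ (big_morph L LD L0) big1 ?scaler0 // => k ki.
by rewrite LZ Lx // scaler0.
Qed.

End Multilinear.

(** There are more matrices than the dimension of the space they live in, so they
    are dependent. *)
Lemma standard_mx (E : fieldType) r N (x : 'I_N -> 'M[E]_r.+1) :
  (r.+1 * r.+1 < N)%N -> standard_poly x = 0.
Proof.
move=> rN; have [c [i ci] cx] := wide_kernel (\matrix_i mxvec (x i)) rN.
apply: (standard_dependent (c := c) (i := i)) => //.
apply: (can_inj mxvecK); rewrite linear_sum linear0; apply/rowP => j.
rewrite summxE mxE -[RHS](cx j); apply: eq_bigr => k _.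
by rewrite linearZ !mxE.
Qed.

Lemma standard_mx_poly (F : fieldType) r N (x : 'I_N -> 'M[{poly F}]_r.+1) :
  (r.+1 * r.+1 < N)%N -> standard_poly x = 0.
Proof.
move=> rN; pose f : {poly F} -> {fraction {poly F}} := @tofrac _.
have /matrixP fx : map_mx f (standard_poly x) = 0.
  by rewrite standard_rmorph standard_mx.
by apply/matrixP => i j; apply/eqP; have := fx i j; rewrite !mxE => /eqP; rewrite tofrac_eq0.
Qed.

Lemma converse_prod (R : nzRingType) N (y : 'I_N -> R) :
  \prod_(i < N) (y i : R^c) = \prod_(i < N) y (rev_ord i).
Proof.
elim: N y => [|N IH] y; first by rewrite !big_ord0.
rewrite big_ord_recl big_ord_recr /= [LHS]/GRing.mul /= IH.
congr (_ * y _); last by apply/val_inj; rewrite /= subnn.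
apply: eq_bigr => i _; congr y; apply/val_inj => /=.
by rewrite /bump /= add1n subnSK.
Qed.

(** Reversing all the products amounts to a permutation of the arguments, which
    affects the standard polynomial by a sign only. *)
Lemma standard_converse (R : nzRingType) N (x : 'I_N -> R) :
  standard_poly x != 0 -> @standard_poly R^c N x != 0.
Proof.
pose r := perm (can_inj (@rev_ordK N)).
suff -> : @standard_poly R^c N x = (-1) ^+ r * standard_poly x :> R.
  by rewrite mulr_sign; case: ifP => // _; rewrite oppr_eq0.
rewrite /standard_poly big_distrr [RHS](reindex_inj (mulgI r)) /=.
apply: eq_bigr => s _; rewrite mulrA -signr_addb odd_permM addbA addbb addFb.
rewrite mulr_sign [RHS]mulr_sign; suff -> : \prod_(i < N) (x (s i) : R^c) =
    \prod_(i < N) x ((r * s)%g i) by [].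
rewrite (converse_prod (fun i => x (s i))); apply: eq_bigr => i _.
by rewrite permM permE.
Qed.

(** In the free algebra the identity permutation contributes a monomial which no
    other permutation gives, so the standard polynomial is not zero. *)
Lemma not_PI_standard (K : fieldType) (A : algType K) : ~ is_PI A ->
  forall N, exists x : 'I_N -> A, standard_poly x != 0.
Proof.
move=> nPI N; apply: contrapT => nx; apply: nPI.
pose w (s : 'S_N) := FMonom [seq nat_of_ord (s i) | i <- enum 'I_N].
have wI : injective w.
  move=> s t [] e; apply/permP => i; apply/val_inj.
  by move/eq_in_map: e; apply; rewrite mem_enum.
exists (\sum_s mkmalgU (w s) ((-1) ^+ s)).
  apply/eqP => /(congr1 (mcoeff (w (1%g : 'S_N)))).
  rewrite mcoeff0 raddf_sum (bigD1 (1%g : 'S_N)) //= mcoeffUU odd_perm1 expr0 big1 ?addr0.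
    by move/eqP; rewrite oner_eq0.
  by move=> s /negPf s1; rewrite mcoeffU (inj_eq wI) s1.
move=> x; apply: contrapT => xn0; apply: nx.
exists (fun i => x (nat_of_ord i)); apply/eqP => x0; apply: xn0.
rewrite -x0 raddf_sum; apply: eq_bigr => s _; rewrite /= mmapU; congr (_ * _).
  exact: (rmorph_sign (in_alg A)).
by rewrite /w /= big_map enumT.
Qed.

End StandardPolynomial.

(** * Rank over the polynomials in one element *)

Section Converse.
Variables (F : fieldType) (Q : algType F).

(** The left-hand versions of statements about the algebra generated by V are
    the right-hand ones in the converse algebra. *)
HB.instance Definition _ := GRing.Lmodule.copy Q^c Q.

HB.instance Definition _ :=
  GRing.Lmodule_isLalgebra.Build F Q^c (fun a x y => @scalerAr _ Q a y x).

HB.instance Definition _ :=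
  GRing.Lalgebra_isAlgebra.Build F Q^c (fun a x y => @scalerAl _ Q a y x).

Lemma converse_mul (X Y : set Q) : @ideal_mul F Q^c X Y = Y ** X.
Proof.
by congr span; apply/seteqP; split=> _ [x [y [Xx Yy ->]]]; exists y, x.
Qed.

Lemma converse_spow (X : set Q) n : is_subspace X -> @spow F Q^c X n = spow X n.
Proof.
move=> sX; elim: n => [|n IH] //.
by rewrite spowSr //= IH converse_mul.
Qed.

Lemma converse_horner (a : Q) p : @horner_alg F Q^c a p = horner_alg a p.
Proof.
rewrite !horner_algE; apply: eq_bigr => i _; congr (_ *: _); exact: revrX.
Qed.

End Converse.

Definition no_standard_identity (F : fieldType) (Q : algType F) (V : set Q) : Prop :=
  forall N, exists k (c : 'I_N -> Q), (forall i, spow V k (c i)) /\ standard_poly c != 0.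

Section Rank.
Variables (F : fieldType) (Q : algType F) (V : set Q).
Hypotheses (gV : fin_gen V) (V1 : V 1).
Hypothesis nPI : no_standard_identity V.

Variables (a : Q) (ta : transcendental a).
Local Notation ev := (horner_alg a).

Let R : set Q := range ev.

Let evC p q : ev p * ev q = ev q * ev p.
Proof. by rewrite -!rmorphM mulrC. Qed.

Let subspace_mulR X : is_subspace (X ** R).
Proof. exact: subspace_mul. Qed.

Let mulR_ev X x q : (X ** R) x -> (X ** R) (x * ev q).
Proof.
move: x; apply: mul_sub; first exact/subspace_rmul/subspace_mulR.
move=> x _ Xx [p _ <-] /=; rewrite -mulrA -rmorphM; apply: mem_mul => //.
by exists (p * q).
Qed.

(** If each generator v of V^(m+1) had its own nonzero q with v q(a) in V^m F[a],
    the product of these q would do for all of V^(m+1).  So there is for each i an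
    element of V^i none of whose multiples by nonzero polynomials in a falls into
    V^(i-1) F[a], and these elements are independent over F[a]. *)
Lemma right_polynomial_basis :
  (forall m q, q != 0 -> ~ forall x, spow V m.+1 x -> (spow V m ** R) (x * ev q)) ->
  forall n, exists b : 'I_n.+1 -> Q, (forall i, spow V n (b i)) /\
    forall p : 'I_n.+1 -> {poly F}, \sum_i b i * ev (p i) = 0 -> forall i, p i = 0.
Proof.
move=> H n; pose Low i := if i is j.+1 then spow V j ** R else [set 0].
have /choice[b bP] : forall i, exists b, spow V i b /\
    forall q, q != 0 -> ~ Low i (b * ev q).
  case=> [|i].
    exists 1; split=> [|q q0]; first exact: span_sub.
    by rewrite /Low mul1r => /ta/eqP; rewrite (negPf q0).
  apply: contrapT => nb.
  have [r [v vE]] := fin_gen_spow i.+1 gV.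
  have /choice[q qP] : forall k : 'I_r, exists q, q != 0 /\ (spow V i ** R) (v k * ev q).
    move=> k; apply: contrapT => nq; apply: nb; exists (v k); split.
      by rewrite vE; apply: span_sub; exists k.
    by move=> q q0 Lq; apply: nq; exists q.
  apply: (H i (\prod_k q k)); first by apply/prodf_neq0 => k _; case: (qP k).
  rewrite vE; apply: span_subspace; first exact/subspace_rmul/subspace_mulR.
  move=> _ [k _ <-] /=; rewrite (bigD1 k) //= rmorphM mulrA; apply: mulR_ev.
  by case: (qP k).
exists b; split=> [i|p p0 i].
  by apply: (spow_leq V1 (leq_ord i)); case: (bP i).
apply/eqP/negPn/negP => pi.
have [k pk kmax] := @arg_maxnP _ i (fun j => p j != 0) val pi.
have [_ /(_ _ pk)] := bP k; apply.
move: p0; rewrite (bigD1 k) //= => /eqP; rewrite addr_eq0 => /eqP ->.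
have sL : is_subspace (Low k).
  by case: (nat_of_ord k) => [|j]; [exact: subspace0|exact: subspace_mulR].
apply: (subspaceN sL); apply: (subspace_sum sL) => j jk.
have [->|pj] := eqVneq (p j) 0; first by rewrite rmorph0 mulr0; case: sL.
have : (j < k)%N by rewrite ltn_neqAle jk; apply: kmax.
rewrite /Low; case: (nat_of_ord k) => // l; rewrite ltnS => jl.
apply: mem_mul; last by exists (p j).
by apply: (spow_leq V1 jl); case: (bP j).
Qed.

Lemma mul_rangeP r (v : 'I_r -> Q) x : (span (range v) ** R) x ->
  exists f : 'I_r -> {poly F}, x = \sum_j v j * ev (f j).
Proof.
move: x; apply: span_subspace.
  split; first by exists (fun=> 0); rewrite big1 // => j _; rewrite rmorph0 mulr0.
  move=> k _ _ [f ->] [g ->]; exists (fun j => k *: f j + g j).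
  rewrite scaler_sumr -big_split; apply: eq_bigr => j _ /=.
  by rewrite linearD linearZ /= mulr_algl mulrDr scalerAr.
move=> _ [y [_ [vy [p _ <-] ->]]]; have [c ->] := (@span_rangeP _ _ _ v y).1 vy.
exists (fun j => c j *: p); rewrite mulr_suml; apply: eq_bigr => j _.
by rewrite linearZ /= mulr_algl -scalerAl scalerAr.
Qed.

(** When V^(m+1) q(a) lies in V^m F[a], an element c of V^k maps V^m q(a)^k into
    V^m F[a], hence acts on the generators of V^m through a matrix over F[t].
    Matrices of products are products of matrices, so a standard polynomial of
    degree exceeding the square of the size annihilates V^m up to a power of
    q(a), although some value g of it on the algebra is not zero.  Finally
    g V^n q(a)^n lies in g V^m F[a]. *)
Lemma right_rank :
  (forall n, exists b : 'I_n.+1 -> Q, (forall i, spow V n (b i)) /\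
    forall p : 'I_n.+1 -> {poly F}, \sum_i b i * ev (p i) = 0 -> forall i, p i = 0) \/
  (exists g q p, [/\ g != 0, q != 0, p != 0
    & forall n x, spow V n x -> g * x * ev (q ^+ n * p) = 0]).
Proof.
have [[m [q [q0 mq]]]|H] := pselect (exists m q, q != 0 /\
    forall x, spow V m.+1 x -> (spow V m ** R) (x * ev q)); last first.
  by left; apply: right_polynomial_basis => m q q0 mq; apply: H; exists m, q.
right.
have mqn n x : spow V (n + m) x -> (spow V m ** R) (x * ev (q ^+ n)).
  elim: n x => [|n IH] x.
    by move=> Vx; apply: mem_mul => //; exists (q ^+ 0).
  move: x; apply: mul_sub => [|v y Vv Vy /=]; first exact/subspace_rmul/subspace_mulR.
  rewrite exprSr rmorphM -mulrA (mulrA y).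
  move: (y * _) (IH y Vy); apply: mul_sub.
    exact: (subspace_rmul (ev q) (subspace_lmul v (subspace_mulR _))).
  move=> z _ Vz [p _ <-] /=; rewrite -mulrA evC !mulrA; apply: mulR_ev.
  by apply: mq; apply: mem_mul.
have [r [v vE]] := fin_gen_spow m gV.
case: r => [|r] in v vE *.
  have : span (range v) 1 by rewrite -vE; apply: (spow_leq V1 (leq0n m)); apply: span_sub.
  by move=> /span_rangeP[c]; rewrite big_ord0 => /eqP; rewrite oner_eq0.
set N := (r.+1 * r.+1).+1.
have [k [c [cV c0]]] := nPI N.
have /choice[M ME] : forall t : 'I_N, exists M : 'M[{poly F}]_r.+1, forall i,
    c t * v i * ev (q ^+ k) = \sum_j v j * ev (M j i).
  move=> t; have /choice[f fE] : forall i, exists f : 'I_r.+1 -> {poly F},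
      c t * v i * ev (q ^+ k) = \sum_j v j * ev (f j).
    move=> i; apply: mul_rangeP; rewrite -vE; apply: mqn.
    rewrite spowD; apply: mem_mul => //; rewrite vE; apply: span_sub; by exists i.
  exists (\matrix_(j, i) f i j) => i; rewrite fE.
  by apply: eq_bigr => j _; rewrite mxE.
have MP ts i : (\prod_(t <- ts) c t) * v i * ev (q ^+ (k * size ts)) =
    \sum_j v j * ev ((\prod_(t <- ts) M t) j i).
  elim: ts i => [|t ts IH] i.
    rewrite !big_nil muln0 expr0 rmorph1 mulr1 mul1r (bigD1 i) //= mxE eqxx.
    rewrite rmorph1 mulr1 big1 ?addr0 // => j ji.
    by rewrite mxE (negPf ji) rmorph0 mulr0.
  rewrite !big_cons /= mulnS addnC exprD rmorphM.
  rewrite -!mulrA (mulrA _ (v i)) (mulrA _ (ev _)) IH.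
  rewrite mulr_suml mulr_sumr.
  transitivity (\sum_j \sum_l v l * ev (M t l j) * ev ((\prod_(t <- ts) M t) j i)).
    apply: eq_bigr => j _; rewrite -mulr_suml -ME -!mulrA; congr (_ * (_ * _)).
    exact: evC.
  rewrite exchange_big; apply: eq_bigr => l _ /=.
  rewrite mxE raddf_sum mulr_sumr; apply: eq_bigr => j _.
  by rewrite -mulrA -rmorphM.
have gV0 i : standard_poly c * v i * ev (q ^+ (k * N)) = 0.
  transitivity (\sum_j v j * ev ((standard_poly M) j i)); last first.
    by rewrite standard_mx_poly // big1 // => j _; rewrite mxE rmorph0 mulr0.
  rewrite /standard_poly !mulr_suml.
  have MPs (s : 'S_N) : \prod_(t < N) c (s t) * v i * ev (q ^+ (k * N)) =
      \sum_j v j * ev ((\prod_(t < N) M (s t)) j i).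
    have := MP (map s (index_enum 'I_N)) i.
    have -> : size (map s (index_enum 'I_N)) = N.
      by rewrite size_map [index_enum _]unlock -enumT size_enum_ord.
    by rewrite !(big_map s xpredT).
  under eq_bigr => s _ do rewrite -!mulrA [X in _ * X]mulrA MPs mulr_sumr.
  rewrite exchange_big; apply: eq_bigr => j _ /=.
  rewrite summxE raddf_sum mulr_sumr; apply: eq_bigr => s _.
  rewrite !mulr_sign; case: ifP => _ //.
  by rewrite mxE raddfN mulrN.
exists (standard_poly c), q, (q ^+ (k * N)); split=> //; do ?exact: expf_neq0.
move=> n x Vx; rewrite rmorphM mulrA -(mulrA (standard_poly c)).
have {Vx} Vx : spow V (n + m) x by apply: (spow_leq V1 (leq_addr m n)).
pose Z := [set t | standard_poly c * t * ev (q ^+ (k * N)) = 0].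
have sZ : is_subspace Z.
  exact: (subspace_lmul (standard_poly c) (subspace_rmul _ (subspace0 _))).
suff : spow V m ** R `<=` Z by move=> /(_ _ (mqn n x Vx)).
apply: mul_sub => // y _ + [p _ <-]; rewrite vE => vy.
rewrite /Z /= -!mulrA evC !mulrA.
move: y vy; apply: span_subspace => [|_ [i _ <-]] /=; last by rewrite gV0 mul0r.
exact: (subspace_lmul (standard_poly c) (subspace_rmul _ (subspace_rmul _ (subspace0 _)))).
Qed.

End Rank.

Section LeftRank.
Variables (F : fieldType) (Q : algType F) (V : set Q).
Hypotheses (gV : fin_gen V) (V1 : V 1).
Hypothesis nPI : no_standard_identity V.

Lemma left_rank a : transcendental a ->
  (forall n, exists b : 'I_n.+1 -> Q, (forall i, spow V n (b i)) /\
    forall p : 'I_n.+1 -> {poly F},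
      \sum_i horner_alg a (p i) * b i = 0 -> forall i, p i = 0) \/
  (exists g q p, [/\ g != 0, q != 0, p != 0
    & forall n x, spow V n x -> horner_alg a (q ^+ n * p) * x * g = 0]).
Proof.
move=> ta; have sV := fin_gen_subspace gV.
have ta' : @transcendental F Q^c a by move=> p; rewrite converse_horner; apply: ta.
have nPI' : @no_standard_identity F Q^c V.
  move=> N; have [k [c [cV c0]]] := nPI N; exists k, c.
  by rewrite converse_spow //; split=> //; apply: standard_converse.
have [H|[g [q [p [g0 q0 p0 H]]]]] := @right_rank F Q^c V gV V1 nPI' a ta'.
  left=> n; have [b [bV bP]] := H n; exists b; split.
    by move=> i; have := bV i; rewrite converse_spow.
  move=> p p0; apply: bP; rewrite -[RHS]p0; apply: eq_bigr => i _.
  by rewrite converse_horner.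
right; exists g, q, p; split=> // n x Vx.
rewrite -mulrA; have := H n x; rewrite converse_spow // converse_horner; exact.
Qed.

End LeftRank.

(** * Elements annihilated on both sides *)

(** Primeness of the algebra generated by V, tested against all elements of Q. *)
Definition prime_generators (F : fieldType) (Q : algType F) (V : set Q) : Prop :=
  forall x y : Q, x != 0 -> y != 0 -> exists n b, spow V n b /\ x * b * y != 0.

Section TwoSided.
Variables (F : fieldType) (Q : algType F) (V : set Q).
Hypotheses (sV : is_subspace V) (V1 : V 1).
Hypothesis primeV : prime_generators V.

Definition sum_sp (X Y : set Q) : set Q :=
  [set z | exists x y, [/\ X x, Y y & z = x + y]].

Lemma subspace_sum_sp X Y : is_subspace X -> is_subspace Y -> is_subspace (sum_sp X Y).
Proof.
move=> [X0 XD] [Y0 YD]; split; first by exists 0, 0; rewrite addr0.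
move=> a _ _ [x [y [Xx Yy ->]]] [x' [y' [Xx' Yy' ->]]].
exists (a *: x + x'), (a *: y + y'); split; [exact: XD|exact: YD|].
by rewrite scalerDr addrACA.
Qed.

(** Let B be the algebra generated by V.  Elements of V^i y V^j outside
    V^(i-1) y B + V^i y V^(j-1), for i, j <= n, form a triangular family.  If there
    is no such element for some i and j, then B y B is contained in
    V^(i-1) y B + B y V^(j-1), so that g B y B h = 0: this contradicts
    primeness. *)
Lemma annihilated_growth n (g y h : Q) : g != 0 -> y != 0 -> h != 0 ->
  (forall x, spow V n x -> g * x * y = 0) ->
  (forall x, spow V n x -> y * x * h = 0) ->
  has_indep (spow V n ** ([set y] ** spow V n)) (n.+1 ^ 2).
Proof.
move=> g0 y0 h0 gy yh.
pose B : set Q := [set x | exists m, spow V m x].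
pose pv i : set Q := if i is j.+1 then spow V j else [set 0].
pose T X Y := X ** ([set y] ** Y).
have mT (X Y : set Q) u v : X u -> Y v -> T X Y (u * (y * v)).
  by move=> Xu Yv; apply: mem_mul => //; apply: mem_mul.
have sT X Y : is_subspace (T X Y) by apply: subspace_mul.
have Tsub (X Y Z : set Q) : is_subspace Z ->
    (forall u v, X u -> Y v -> Z (u * (y * v))) -> T X Y `<=` Z.
  move=> sZ H; apply: mul_sub => // u t Xu; move: t.
  apply: mul_sub; first exact: (subspace_lmul u sZ).
  by move=> _ v -> Yv; apply: H.
have pvS i : pv i `<=` spow V i.
  case: i => [_ ->|i]; first by case: (subspace_spow V 0).
  exact: (spow_leq V1).
have VB i : spow V i `<=` B by move=> x Vx; exists i.
pose Z k i j := sum_sp (T (pv i) B) (T (spow V (k + i)) (pv j)).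
have sZ k i j : is_subspace (Z k i j) by apply: subspace_sum_sp.
have Zl k i j x : T (pv i) B x -> Z k i j x.
  by move=> Tx; exists x, 0; rewrite addr0; split=> //; case: (sT (spow V (k + i)) (pv j)).
have Zr k i j x : T (spow V (k + i)) (pv j) x -> Z k i j x.
  by move=> Tx; exists 0, x; rewrite add0r; split=> //; case: (sT (pv i) B).
have key i j : (i <= n)%N -> (j <= n)%N ->
    exists x, T (spow V i) (spow V j) x /\ ~ Z 0 i j x.
  move=> le_in le_jn; apply: contrapT => nx.
  have sub0 : T (spow V i) (spow V j) `<=` Z 0 i j.
    by move=> x Tx; apply: contrapT => nZ; apply: nx; exists x.
  (* If V^i y V^j lies in V^(i-1) y B + V^i y V^(j-1), so does V^i y B, since
     the right-hand side absorbs right multiplication by V. *)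
  have Zmulr x v : Z 0 i j x -> V v -> Z 0 i j (x * v).
    move=> [x1 [x2 [Tx1 Tx2 ->]]] Vv; rewrite mulrDl.
    apply: (subspaceD (sZ 0%N i j)).
      apply: Zl; move: x1 Tx1; apply: (Tsub); first exact: (subspace_rmul v (sT _ _)).
      move=> u b pu [m Vb] /=; rewrite -!mulrA; apply: mT => //.
      by exists m.+1; rewrite spowSr //; apply: mem_mul.
    apply: sub0; move: x2 Tx2; apply: (Tsub); first exact: (subspace_rmul v (sT _ _)).
    move=> u b Vu + /=; rewrite -!mulrA /pv; case: (j) => [->|j'] Vb.
      by rewrite mul0r; apply: mT => //; case: (subspace_spow V 0).
    by apply: mT => //; rewrite spowSr //; apply: mem_mul.
  have sub1 : T (spow V i) B `<=` Z 0 i j.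
    apply: (Tsub) => // u b Vu [m]; move: b; elim: m => [|m IH] b Vb.
      by apply: sub0; apply: mT => //; apply: (spow_leq V1 (leq0n j)).
    move: Vb; rewrite spowSr //; move: b.
    apply: mul_sub; first exact: (subspace_lmul y (subspace_lmul u (sZ _ _ _))).
    by move=> b v Vb Vv /=; rewrite !mulrA; apply: Zmulr => //; rewrite -mulrA; apply: IH.
  have sub2 k : T (spow V (k + i)) B `<=` Z k i j.
    elim: k => // k IH; apply: (Tsub) => // u b + Bb; rewrite addSn /=; move: u.
    apply: mul_sub; first exact: (subspace_rmul (y * b) (sZ _ _ _)).
    move=> v u Vv Vu /=; rewrite -mulrA.
    have [x1 [x2 [Tx1 Tx2 ->]]] := IH _ (mT _ _ _ _ Vu Bb).
    rewrite mulrDr; apply: (subspaceD (sZ _ _ _)).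
      have : Z 0 i j (v * x1).
        apply: sub1; move: x1 Tx1; apply: (Tsub); first exact: (subspace_lmul v (sT _ _)).
        move=> w c + Bc /=; rewrite mulrA /pv; case: (i) => [->|i'] Vw.
          by rewrite mulr0; apply: mT => //; case: (subspace_spow V 0).
        by apply: mT => //; apply: mem_mul.
      move=> [z1 [z2 [Tz1 Tz2 ->]]]; exists z1, z2; split=> //.
      apply: mul_mono Tz2 => // w; apply: (spow_leq V1); exact: leq_addl.
    apply: Zr; move: x2 Tx2; apply: (Tsub); first exact: (subspace_lmul v (sT _ _)).
    by move=> w c Vw pc /=; rewrite mulrA; apply: mT => //; apply: mem_mul.
  have [n1 [b [Vb gby]]] := primeV g0 y0.
  have [n2 [c [Vc gbych]]] := primeV gby h0.
  have : T (spow V (n1 + i)) B (b * (y * c)).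
    by apply: mT; [apply: (spow_leq V1 (leq_addr i n1))|exists n2].
  move=> /sub2[x1 [x2 [Tx1 Tx2 e]]].
  move/eqP: gbych; apply; rewrite -!mulrA (mulrA y) (mulrA b) e mulrDl mulrDr.
  have -> : g * (x1 * h) = 0.
    move: x1 Tx1 {e}.
    have s0 : is_subspace [set x | g * (x * h) = 0].
      exact: (subspace_rmul h (subspace_lmul g (subspace0 Q))).
    apply: (Tsub) => // u v pu _ /=; rewrite !mulrA gy ?mul0r //.
    by have := pvS i u pu; apply: (spow_leq V1).
  rewrite add0r; move: x2 Tx2 {e}.
  have s0 : is_subspace [set x | g * (x * h) = 0].
    exact: (subspace_rmul h (subspace_lmul g (subspace0 Q))).
  apply: (Tsub) => // u v _ pu /=; rewrite -(mulrA u) yh ?mulr0 //.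
  by have := pvS j v pu; apply: (spow_leq V1).
have /choice[x xP] : forall ij : 'I_n.+1 * 'I_n.+1, exists x,
    T (spow V ij.1) (spow V ij.2) x /\ ~ Z 0%N ij.1 ij.2 x.
  by move=> [i j]; apply: key; apply: leq_ord.
have -> : (n.+1 ^ 2 = #|{: 'I_n.+1 * 'I_n.+1}|)%N by rewrite card_prod card_ord.
apply: (@indep_has_indep _ _ _ x); last first.
  move=> [i j]; have [+ _] := xP (i, j); apply: mul_mono => /=.
    by apply: (spow_leq V1); apply: leq_ord.
  by apply: mul_mono => //; apply: (spow_leq V1); apply: leq_ord.
apply: (@triangular_indep _ _ _ (fun ij : 'I_n.+1 * 'I_n.+1 => ij.1 * n.+1 + ij.2)%N
  (fun ij => Z 0%N ij.1 ij.2)) => //.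
- move=> [i j] [i' j'] /= e.
  have := congr1 (fun k => k %/ n.+1)%N e; have /= := congr1 (fun k => k %% n.+1)%N e.
  rewrite !modnMDl !divnMDl // !modn_small // !divn_small // !addn0.
  by move=> jj ii; congr pair; apply: val_inj.
- move=> [i j] [i' j'] /= lt; have [Tx _] := xP (i', j').
  have [lti|gei] := ltnP i' i.
    apply: Zl; apply: mul_mono Tx => /=.
      case: (nat_of_ord i) lti => // k; rewrite ltnS => ik; exact: (spow_leq V1).
    by apply: mul_mono => // z; exists j'.
  have lj := ltn_ord j; have lj' := ltn_ord j'.
  have ii : i' = i :> nat by apply/eqP; rewrite eqn_leq gei andbT; nia.
  have jj : (j' < j)%N by move: lt; rewrite ii ltn_add2l.
  apply: Zr; apply: mul_mono Tx => /=; first by rewrite ii.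
  apply: mul_mono => //; case: (nat_of_ord j) jj => // k; rewrite ltnS => jk.
  exact: (spow_leq V1).
- by move=> ij; have [] := xP ij.
Qed.

End TwoSided.

(** * Quadratic growth relative to a subspace *)

Lemma sum_pair (U : zmodType) (I J : finType) (G : I * J -> U) :
  \sum_ij G ij = \sum_i \sum_j G (i, j).
Proof. by rewrite pair_bigA; apply: eq_bigr => -[]. Qed.

Section JointIndependence.
Variables (F : fieldType) (Q : lmodType F).

(** The coordinates of the vectors phi k j form a matrix with N independent rows
    and r D columns, where D is the dimension of Y. *)
Lemma joint_indep (Y : set Q) N r (phi : 'I_r -> 'I_N -> Q) : fin_gen Y ->
  (forall k j, Y (phi k j)) ->
  (forall c : 'I_N -> F, (forall k, \sum_j c j *: phi k j = 0) -> forall j, c j = 0) ->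
  exists D, (N <= r * D)%N /\ has_indep Y D.
Proof.
move=> gY Yphi inj; have [D [y [iy Yy YE]]] := fin_gen_basis gY.
exists D; split; last by exists y.
have /choice[M ME] : forall kj : 'I_r * 'I_N, exists c : 'I_D -> F,
    phi kj.1 kj.2 = \sum_t c t *: y t.
  by move=> kj; apply/span_rangeP; rewrite -YE.
rewrite leqNgt; apply/negP => rDN.
have rDN' : (#|{: 'I_r * 'I_D}| < N)%N by rewrite card_prod !card_ord.
have [c [j cj] cM] := wide_kernel
  (\matrix_(j < N, kt < #|{: 'I_r * 'I_D}|) M ((enum_val kt).1, j) (enum_val kt).2) rDN'.
move/eqP: cj; apply; apply: inj => k.
under eq_bigr => i _ do rewrite (ME (k, i)) scaler_sumr.
rewrite exchange_big big1 // => t _ /=.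
under eq_bigr do rewrite scalerA.
rewrite -scaler_suml (_ : \sum_i _ = 0) ?scale0r //.
rewrite -[RHS](cM (enum_rank (k, t))); apply: eq_bigr => i _.
by rewrite mxE enum_rankK.
Qed.

(** The dimensions of the D n are bounded, so the sequence is stationary. *)
Lemma decreasing_common (D : nat -> set Q) M : (forall n, is_subspace (D n)) ->
  (forall n, D n.+1 `<=` D n) -> (forall n, exists2 x, D n x & x != 0) ->
  ~ has_indep (D 0%N) M -> exists2 x, x != 0 & forall n, D n x.
Proof.
move=> sD dD nD D0.
have le_D m n : (m <= n)%N -> D n `<=` D m.
  by move=> /subnK <-; elim: (n - m)%N => // k IH x /dD/IH.
have ex : exists k, `[< exists n, ~ has_indep (D n) k >] by exists M; apply/asboolP; exists 0%N.
case: (ex_minnP ex) => [[|k] /asboolP[n0 nk] kmin]; first by case: nk; apply: has_indep0.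
have [x Dx x0] := nD n0; exists x => // n.
have [le_nn0|lt_n0n] := leqP n n0; first exact: (le_D _ _ le_nn0).
have [b ib Db] : has_indep (D n) k.
  apply: contrapT => nk'; have : (k.+1 <= k)%N by apply: kmin; apply/asboolP; exists n.
  by rewrite ltnn.
have Db0 i : D n0 (b i) by apply: (le_D _ _ (ltnW lt_n0n)).
have := not_indep_extend ib Db0 nk Dx; apply: span_subspace => // _ [i _ <-].
exact: Db.
Qed.

End JointIndependence.

Section QuadraticGrowth.
Variables (F : fieldType) (Q : algType F) (V : set Q).
Hypotheses (gV : fin_gen V) (V1 : V 1).
Hypothesis primeV : prime_generators V.
Hypothesis nPI : no_standard_identity V.

Let sV : is_subspace V := fin_gen_subspace gV.

(** The factor W^n is there because a central element that maps W into the
    algebra can be multiplied n times into W^n. *)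
Definition quadratic (W : set Q) : Prop := exists c, forall n, exists N,
  (n ^ 2 <= c * N)%N /\
  has_indep (spow V (c * n.+1) ** (spow W n ** spow V (c * n.+1))) N.

Section Weight.
Variables (W : set Q) (d : nat).
Hypotheses (gW : fin_gen W) (WV : W `<=` spow V d).

Lemma spow_weight n : spow W n `<=` spow V (d * n).
Proof. by rewrite -spowM; apply: spow_mono. Qed.

(** Each of the surplus factors from W counts as d factors from V. *)
Lemma sandwich C m n a b : (a <= C)%N -> (n <= m)%N -> (d * (m - n) + b <= C)%N ->
  spow V a ** (spow W m ** spow V b) `<=` spow V C ** (spow W n ** spow V C).
Proof.
move=> aC nm bC; apply: mul_mono; first exact: (spow_leq V1).
rewrite -{1}(subnKC nm) spowD mulspA; apply: mul_mono => //.
apply: subset_trans (spow_leq V1 bC); rewrite spowD; apply: mul_mono => //.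
exact: spow_weight.
Qed.

Lemma transcendental_quadratic k a : (0 < k)%N -> spow W k a ->
  transcendental a -> quadratic W.
Proof.
move=> k0 Wa ta; have Wm m : spow W (k * m) (a ^+ m).
  by rewrite -spowM; apply: spow_exp.
pose ev := horner_alg a.
have ev_shift n (c : 'I_n.+1 -> F) :
    ev (\sum_l c l *: 'X^(n + l)) = \sum_l c l *: a ^+ (n + l).
  rewrite /ev linear_sum; apply: eq_bigr => l _.
  by rewrite linearZ /= mulr_algl rmorphXn /= horner_algX.
have coef_shift n (c : 'I_n.+1 -> F) :
    \sum_l c l *: 'X^(n + l) = 0 :> {poly F} -> forall l, c l = 0.
  move=> e l; have := congr1 (fun p : {poly F} => p`_(n + l)) e.
  rewrite coef_sum coef0 (bigD1 l) //= coefZ coefXn eqxx mulr1 big1 ?addr0 //.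
  move=> i il; rewrite coefZ coefXn eqn_add2l eq_sym.
  by rewrite (inj_eq val_inj) (negPf il) mulr0.
have km m : (m <= k * m)%N by rewrite leq_pmull.
have card2 n : (n.+1 ^ 2 = #|{: 'I_n.+1 * 'I_n.+1}|)%N.
  by rewrite card_prod card_ord.
have [HR|[g [q [p [g0 q0 p0 gP]]]]] := right_rank gV V1 nPI ta.
  exists (d * (2 * k) + 1)%N => n; exists (n.+1 ^ 2)%N; split.
    by rewrite mulnDl mul1n (leq_trans _ (leq_addl _ _)) // leq_exp2r.
  have [b [bV bP]] := HR n; rewrite card2.
  apply: (@indep_has_indep _ _ _ (fun il : 'I_n.+1 * 'I_n.+1 => b il.1 * a ^+ (n + il.2))).
    move=> c; rewrite sum_pair /=.
    move=> c0 [i l]; apply: (coef_shift n (fun l => c (i, l))).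
    apply: (bP (fun i => \sum_l c (i, l) *: 'X^(n + l))).
    rewrite -[RHS]c0; apply: eq_bigr => j _; rewrite -/ev ev_shift mulr_sumr.
    by apply: eq_bigr => m _; rewrite scalerAr.
  move=> [i l] /=; apply: (@sandwich _ (k * (n + l)) n n 0).
  - nia.
  - exact: leq_trans (leq_addr _ _) (km _).
  - by have := leq_ord l; nia.
  by apply: mem_mul => //; rewrite mulsp1 //; apply: subspace_spow.
have [HL|[h [q' [p' [h0 q'0 p'0 hP]]]]] := left_rank gV V1 nPI ta.
  exists (d * (2 * k) + 1)%N => n; exists (n.+1 ^ 2)%N; split.
    by rewrite mulnDl mul1n (leq_trans _ (leq_addl _ _)) // leq_exp2r.
  have [b [bV bP]] := HL n; rewrite card2.
  apply: (@indep_has_indep _ _ _ (fun il : 'I_n.+1 * 'I_n.+1 => a ^+ (n + il.2) * b il.1)).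
    move=> c; rewrite sum_pair /=.
    move=> c0 [i l]; apply: (coef_shift n (fun l => c (i, l))).
    apply: (bP (fun i => \sum_l c (i, l) *: 'X^(n + l))).
    rewrite -[RHS]c0; apply: eq_bigr => j _; rewrite -/ev ev_shift mulr_suml.
    by apply: eq_bigr => m _; rewrite scalerAl.
  move=> [i l] /=; apply: (@sandwich _ (k * (n + l)) n 0 n).
  - nia.
  - exact: leq_trans (leq_addr _ _) (km _).
  - by have := leq_ord l; nia.
  rewrite mul1sp; last exact: subspace_mul.
  exact: mem_mul.
pose s := (1 + size q + size p + size q' + size p')%N.
exists (d * (k * s) + 1)%N => n; exists (n.+1 ^ 2)%N; split.
  by rewrite mulnDl mul1n (leq_trans _ (leq_addl _ _)) // leq_exp2r.
(* The factor 'X^n puts y in W^n V^e for some e of order n; the other factors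
   give g V^n y = 0 and y V^n h = 0. *)
pose P := 'X^n * (q ^+ n * p) * (q' ^+ n * p'); pose y := ev P.
have y0 : y != 0.
  apply/eqP => /ta/eqP; rewrite /P !mulf_eq0 !expf_eq0 polyX_eq0 andbF.
  by rewrite (negPf q0) (negPf p0) (negPf q'0) (negPf p'0) !andbF.
have sP : (size P <= s * n.+1)%N.
  have H1 := size_polyMleq ('X^n * (q ^+ n * p)) (q' ^+ n * p').
  have H2 := size_polyMleq ('X^n) (q ^+ n * p); rewrite size_polyXn in H2.
  have H3 := size_polyMleq (q ^+ n) p; have H4 := size_polyMleq (q' ^+ n) p'.
  have H5 := size_exp_leq q n; have H6 := size_exp_leq q' n.
  have H7 : ((size q).-1 * n <= size q * n)%N by rewrite leq_mul2r leq_pred orbT.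
  have H8 : ((size q').-1 * n <= size q' * n)%N by rewrite leq_mul2r leq_pred orbT.
  rewrite /P /s !mulnDl mul1n !(mulnS (size _)).
  by clear -H1 H2 H3 H4 H5 H6 H7 H8; lia.
have Pz i : (i < n)%N -> P`_i = 0.
  by move=> lt_in; rewrite /P -mulrA coefXnM lt_in.
have yW : (spow W n ** spow V (d * (k * s * n.+1))) y.
  set Y := _ ** _; have sY : is_subspace Y by apply: subspace_mul.
  rewrite /y /ev horner_algE; apply: (subspace_sum sY) => i _.
  have [lt_in|le_ni] := ltnP i n.
    by rewrite Pz // scale0r; case: sY.
  apply: (subspaceZ sY); have ki := leq_trans le_ni (km i).
  have := Wm i; rewrite -(subnKC ki) spowD; apply: mul_mono => //.
  apply: subset_trans (@spow_weight _) (spow_leq V1 _).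
  rewrite leq_mul2l; apply/orP; right; apply: leq_trans (leq_subr _ _) _.
  by rewrite -mulnA leq_mul2l (leq_trans (ltnW (ltn_ord i))) ?orbT.
have := @annihilated_growth _ _ V sV V1 primeV n g y h g0 y0 h0.
have gy x : spow V n x -> g * x * y = 0.
  move=> Vx; have -> : y = ev (q ^+ n * p) * ev ('X^n * (q' ^+ n * p')).
    by rewrite /ev -rmorphM mulrA (mulrC _ 'X^n).
  by rewrite (mulrA (g * x)) (gP n x Vx) mul0r.
have yh x : spow V n x -> y * x * h = 0.
  move=> Vx; have -> : y = ev ('X^n * (q ^+ n * p)) * ev (q' ^+ n * p').
    by rewrite /ev -rmorphM.
  by rewrite -(mulrA (ev _)) -(mulrA (ev ('X^n * _))) (hP n x Vx) mulr0.
move=> /(_ gy yh); apply: has_indep_sub.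
apply: (@subset_trans _ (spow V n ** (spow W n ** spow V (d * (k * s * n.+1) + n)))).
  apply: mul_mono => //; rewrite spowD -mulspA; apply: mul_mono => // _ ->.
  exact: yW.
by apply: sandwich => //; nia.
Qed.

Lemma quadratic_or_finite : quadratic W \/ finite_powers W.
Proof.
have [|[k [a [k0 Wa ta]]]|H] := growth_alternative gW; first by right.
  by left; apply: (transcendental_quadratic k0 Wa ta).
left; exists (d + 1)%N => n; exists (n.+1 ^ 2)%N; split.
  by rewrite mulnDl mul1n (leq_trans _ (leq_addl _ _)) // leq_exp2r.
apply: has_indep_sub (H n) => x [l [nl ln Wx]].
apply: (@sandwich _ l n 0 0) => //; first by nia.
by rewrite mulsp1 ?mul1sp //; apply: subspace_spow.
Qed.

End Weight.

Lemma fin_gen_bounded (X : set Q) : fin_gen X -> exists M, ~ has_indep X M.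
Proof.
move=> [D [v ->]]; exists D.+1 => /(indep_leq (@subset_refl _ _)).
by rewrite ltnn.
Qed.

(** Standard polynomials vanish on dependent elements, so some standard identity
    holds in an algebra of finite dimension. *)
Lemma not_finite_powers : ~ finite_powers V.
Proof.
move=> [L VL].
have VL' n : spow V n `<=` spow V L.
  apply: subset_trans (VL n) _; apply: span_subspace; first exact: subspace_spow.
  by move=> x [l [lL Vx]]; apply: (spow_leq V1 (ltnW lL)).
have [N nN] := fin_gen_bounded (fin_gen_spow L gV).
have [k [c [cV /eqP[]]]] := nPI N.
apply: contrapT => c0; apply: nN; exists c; last by move=> i; apply: VL'; apply: cV.
move=> e e0 i; apply/eqP/negPn/negP => ei; apply: c0.
exact: standard_dependent e0 ei.
Qed.

Lemma quadratic_self : exists c, forall n, exists N,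
  (n ^ 2 <= c * N)%N /\ has_indep (spow V (c * n.+1)) N.
Proof.
have WV : V `<=` spow V 1 by rewrite spow1.
have [[c H]|/not_finite_powers//] := quadratic_or_finite gV WV.
exists (2 * c + 1)%N => n; have [N [nN iN]] := H n; exists N; split.
  by apply: leq_trans nN _; rewrite leq_mul2r; apply/orP; right; lia.
apply: has_indep_sub iN; rewrite -!spowD; apply: (spow_leq V1); nia.
Qed.

(** If the algebra generated by W has finite dimension, multiply W^n by a
    finite-dimensional space C that is stable under W: this gives a decreasing
    sequence of nonzero finite-dimensional spaces, and x is a common element. *)
Theorem quadratic_weight W d : fin_gen W -> W `<=` spow V d ->
  (forall n, exists2 x, spow W n x & x != 0) -> quadratic W.
Proof.
move=> gW WV nW; have [//|[L WL]] := quadratic_or_finite gW WV.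
set C := span _ in WL.
have sC : is_subspace C by apply: subspace_span.
have CV : C `<=` spow V (d * L).
  apply: span_subspace => [|x [l [lL Wx]]]; first exact: subspace_spow.
  apply: (@spow_leq _ _ V (d * l)) => //; first by rewrite leq_mul2l ltnW ?orbT.
  exact: (spow_weight WV).
pose D n := spow W n ** C.
have sD n : is_subspace (D n) by apply: subspace_mul.
have WC : W ** C `<=` C.
  apply: mul_sub => // w x Ww; move: x; apply: span_subspace.
    exact: (subspace_lmul w sC).
  by move=> x [l [lL Wx]] /=; apply: (WL l.+1); apply: mem_mul.
have dD n : D n.+1 `<=` D n.
  rewrite /D spowSr; last exact: fin_gen_subspace.
  by rewrite mulspA; apply: mul_mono.
have C1 : C 1 by apply: (WL 0%N); apply: span_sub.
have nD n : exists2 x, D n x & x != 0.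
  have [x Wx x0] := nW n; exists x => //; rewrite -[x]mulr1; exact: mem_mul.
have [M nM] := fin_gen_bounded (fin_gen_spow (d * L) gV).
have D0 : ~ has_indep (D 0%N) M.
  move=> iM; apply: nM; apply: has_indep_sub iM.
  by rewrite /D /= mul1sp.
have [x x0 Dx] := decreasing_common sD dD nD D0.
have xW n : (spow W n ** spow V (d * L)) x.
  by apply: mul_mono (Dx n).
have [[n0]|ann] := pselect (exists n0,
    ~ (exists g, g != 0 /\ forall v, spow V n0 v -> g * v * x = 0) \/
    ~ (exists h, h != 0 /\ forall v, spow V n0 v -> x * v * h = 0)); last first.
  exists (d * L + 1)%N => n; exists (n.+1 ^ 2)%N; split.
    by rewrite mulnDl mul1n (leq_trans _ (leq_addl _ _)) // leq_exp2r.
  have [g [g0 gx]] : exists g, g != 0 /\ forall v, spow V n v -> g * v * x = 0.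
    by apply: contrapT => ng; apply: ann; exists n; left.
  have [h [h0 xh]] : exists h, h != 0 /\ forall v, spow V n v -> x * v * h = 0.
    by apply: contrapT => ng; apply: ann; exists n; right.
  have := annihilated_growth sV V1 primeV g0 x0 h0 gx xh; apply: has_indep_sub.
  apply: (@subset_trans _ (spow V n ** (spow W n ** spow V (d * L + n)))).
    apply: mul_mono => //; rewrite spowD -mulspA; apply: mul_mono => // _ ->.
    exact: xW.
  by apply: (sandwich WV) => //; nia.
(* Nothing nonzero annihilates V^n0 x on the left, or x V^n0 on the right.  In
   the first case g is determined by its products with the elements v x, where v
   runs over r generators of V^n0; so N independent elements of V^m lead to at
   least N / r independent elements of V^(m + n0) x. *)
have [c0 H0] := quadratic_self; have [r [v vE]] := fin_gen_spow n0 gV.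
pose c := (c0 * r + c0 + n0 + d * L)%N.
case=> nann; exists c => n; have [N [nN [b ib bV]]] := H0 n.
  pose Y := spow V (c0 * n.+1 + n0) ** (spow W n ** spow V (d * L)).
  have [|||E [NE iE]] := @joint_indep _ _ Y N r (fun k j => b j * (v k * x)).
  - by do 2?[apply: fin_gen_mul]; apply: fin_gen_spow.
  - move=> k j; rewrite mulrA; apply: mem_mul; last exact: xW.
    rewrite spowD; apply: mem_mul => //; rewrite vE; apply: span_sub; by exists k.
  - move=> e e0; apply: ib; apply/eqP/negPn/negP => g0; apply: nann.
    exists (\sum_j e j *: b j); split=> //; rewrite vE.
    apply: span_subspace; first exact: (subspace_lmul _ (subspace_rmul x (subspace0 Q))).
    move=> _ [k _ <-] /=; rewrite -mulrA -[RHS](e0 k) mulr_suml.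
    by apply: eq_bigr => j _; rewrite scalerAl.
  exists E; split.
    apply: leq_trans nN _; apply: leq_trans (leq_mul (leqnn c0) NE) _.
    by rewrite mulnA leq_mul2r /c -!addnA leq_addr orbT.
  apply: has_indep_sub iE; apply: mul_mono; first by apply: (spow_leq V1); rewrite /c; nia.
  by apply: mul_mono => //; apply: (spow_leq V1); rewrite /c; nia.
pose Y := spow W n ** spow V (d * L + (n0 + c0 * n.+1)).
have [|||E [NE iE]] := @joint_indep _ _ Y N r (fun k j => x * v k * b j).
- by apply: fin_gen_mul; apply: fin_gen_spow.
- move=> k j; rewrite -mulrA /Y spowD -mulspA; apply: mem_mul; first exact: xW.
  rewrite spowD; apply: mem_mul => //; rewrite vE; apply: span_sub; by exists k.
- move=> e e0; apply: ib; apply/eqP/negPn/negP => g0; apply: nann.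
  exists (\sum_j e j *: b j); split=> //; rewrite vE.
  apply: span_subspace; first exact: (subspace_lmul x (subspace_rmul _ (subspace0 Q))).
  move=> _ [k _ <-] /=; rewrite -[RHS](e0 k) mulr_sumr.
  by apply: eq_bigr => j _; rewrite scalerAr.
exists E; split.
  apply: leq_trans nN _; apply: leq_trans (leq_mul (leqnn c0) NE) _.
  by rewrite mulnA leq_mul2r /c -!addnA leq_addr orbT.
apply: has_indep_sub iE => z Yz; rewrite -[z]mul1r; apply: mem_mul.
  by apply: (spow_leq V1 (leq0n _)); apply: span_sub.
move: z Yz; apply: mul_mono => //; apply: (spow_leq V1); rewrite /c; nia.
Qed.

End QuadraticGrowth.

(** * The extended centre is a field *)

Section ExtendedCentre.
Variables (K : fieldType) (A : algType K) (primeA : prime_algebra A).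
Local Notation Q := (martindale primeA).
Local Notation iota := (mlmul primeA).
Local Notation pi f := (\pi_(martindale primeA) f).

(** The elements t with x A t = 0 form an ideal, and so do the elements that
    annihilate this ideal on the left. *)
Lemma prime_elements (x y : A) : x != 0 -> y != 0 -> exists a, x * a * y != 0.
Proof.
move=> /eqP x0 /eqP y0; apply: contrapT => na.
have xy a : x * a * y = 0.
  by apply/eqP/negPn/negP => xay; apply: na; exists a.
pose J := [set t | forall a, x * a * t = 0].
have iJ : is_ideal J.
  apply/idealP; split=> [a|s t Js Jt a|c t Jt a|c t Jt a] /=.
  - by rewrite mulr0.
  - by rewrite mulrBr Js Jt subrr.
  - by rewrite mulrA -(mulrA x) Jt.
  - by rewrite mulrA Jt mul0r.
pose I := [set s | forall t, J t -> s * t = 0].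
have iI : is_ideal I.
  apply/idealP; split=> [t _|s s' Is Is' t Jt|c s Is t Jt|c s Is t Jt] /=.
  - by rewrite mul0r.
  - by rewrite mulrBl Is // Is' // subrr.
  - by rewrite -mulrA Is // mulr0.
  - by rewrite -mulrA Is //; apply: (@idealMl _ _ J).
have [s t Is Jt|I0|J0] := primeA iI iJ; first exact: Is.
- have : I x by move=> t /(_ 1); rewrite mulr1.
  by rewrite I0.
- have : J y by move=> a; apply: xy.
  by rewrite J0.
Qed.

Lemma ideal_faithful (L : set A) d : is_ideal L -> L <> [set 0] ->
  (forall l, L l -> d * l = 0) -> d = 0.
Proof.
move=> iL /(neq_set0P iL)[x Lx /eqP x0] dL; apply/eqP/negPn/negP => d0.
have [a /eqP[]] := prime_elements d0 x0.
by rewrite -mulrA dL //; apply: idealMl.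
Qed.

Lemma pi_mulE (f g : partial_hom A) : pi f * pi g = pi (ph_mul primeA f g).
Proof. exact: mmulE. Qed.

Lemma pi_eq0 (f : partial_hom A) : (forall x, phdom f x -> phfun f x = 0) -> pi f = 0.
Proof.
move=> f0; apply/ph_piP; apply: (ph_equivT primeA) => x fx _ /=.
by rewrite f0 // mul0r.
Qed.

Lemma pi_neq0 (f : partial_hom A) : pi f != 0 -> exists2 x, phdom f x & phfun f x != 0.
Proof.
move=> f0; apply: contrapT => nx; move/eqP: f0; apply; apply: pi_eq0 => x fx.
by apply/eqP/negPn/negP => fx0; apply: nx; exists x.
Qed.

Lemma pi_mul_iota (f : partial_hom A) x : phdom f x -> pi f * iota x = iota (phfun f x).
Proof.
move=> fx; rewrite /mlmul pi_mulE; apply/ph_piP.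
by apply: (ph_equivT primeA) => t _ _ /=; rewrite phfunM.
Qed.

(** Multiplication by elements of the domains brings p and q into A. *)
Lemma martindale_prime (p q : Q) : p != 0 -> q != 0 ->
  exists a, p * iota a * q != 0.
Proof.
elim/mpiW: p => f; elim/mpiW: q => g /pi_neq0[y fy fy0] /pi_neq0[x gx gx0].
have [b nb] := prime_elements fy0 gx0.
exists (y * b); apply: contraNneq nb => /(congr1 ( *%R^~ (iota x))) /=.
rewrite mul0r -mulrA (pi_mul_iota gx) pi_mul_iota; last first.
  by apply: idealMr => //; apply: phdom_ideal.
rewrite phfunM // -rmorphM -[X in _ = X -> _](rmorph0 iota) => /mlmul_inj ->.
by [].
Qed.

(** The two sides agree on some nonzero ideal L, and x L is contained in L; so
    their difference annihilates L. *)
Lemma centre_bimodule (f : partial_hom A) : extended_centre (pi f) ->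
  forall a x, phdom f x -> phfun f (a * x) = a * phfun f x.
Proof.
move=> zf a x fx; have := zf (iota a); rewrite /mlmul !pi_mulE => /ph_piP.
move=> [L [iL L0 Ls Le]]; apply/eqP; rewrite -subr_eq0; apply/eqP.
apply: (ideal_faithful iL L0) => l Ll; have iF := phdom_ideal f.
rewrite mulrBl -phfunM; last exact: idealMl.
have /= e := Le (x * l) (idealMl x iL Ll).
by rewrite -mulrA e -mulrA -phfunM // subrr.
Qed.

(** If f (x) = 0 then f (y) a x = f (y a x) = y a f (x) = 0 for all a and all y in
    the domain, so x = 0 or f = 0. *)
Lemma centre_injective (f : partial_hom A) : extended_centre (pi f) -> pi f != 0 ->
  forall x, phdom f x -> phfun f x = 0 -> x = 0.
Proof.
move=> zf /pi_neq0[y fy fy0] x fx x0; apply/eqP/negPn/negP => xn0.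
have [a /eqP[]] := prime_elements fy0 xn0.
by rewrite -!phfunM ?(centre_bimodule zf) ?x0 ?mulr0 //; apply: idealMr => //; apply: phdom_ideal.
Qed.

(** A nonzero central element is given by an injective bimodule map f, whose
    inverse is a bimodule map on the ideal f (phdom f). *)
Lemma centre_inverse (z : Q) : extended_centre z -> z != 0 ->
  exists w, [/\ extended_centre w, z * w = 1 & w * z = 1].
Proof.
elim/mpiW: z => f zf z0; have iF := phdom_ideal f.
have inj := centre_injective zf z0; have lin := centre_bimodule zf.
pose J := [set phfun f x | x in phdom f].
have fB x y : phdom f x -> phdom f y -> phfun f (x - y) = phfun f x - phfun f y.
  move=> fx fy; apply/eqP; rewrite eq_sym subr_eq -phfunD ?subrK //.
  by have /idealP[_ IB _ _] := iF; apply: IB.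
have iJ : is_ideal J.
  apply/idealP; split=> [|_ _ [x fx <-] [y fy <-]|a _ [x fx <-]|a _ [x fx <-]].
  - by exists 0; [exact: ideal0|exact: phfun0].
  - by exists (x - y); [case/idealP: iF => _ IB _ _; apply: IB|rewrite fB].
  - by exists (a * x); [exact: idealMl|rewrite lin].
  - by exists (x * a); [exact: idealMr|rewrite phfunM].
have J0 : J <> [set 0].
  by have [x fx /eqP fx0] := pi_neq0 z0; apply/(neq_set0P iJ); exists (phfun f x) => //; exists x.
have /choice[g gP] : forall y, exists x, J y -> phdom f x /\ phfun f x = y.
  move=> y; have [[x fx xy]|nJ] := pselect (J y); first by exists x.
  by exists 0.
have gf x : phdom f x -> g (phfun f x) = x.
  move=> fx; have [fg e] := gP (phfun f x) (ex_intro2 _ _ x fx erefl).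
  apply/eqP; rewrite -subr_eq0; apply/eqP; apply: inj; last by rewrite fB // e subrr.
  by have /idealP[_ IB _ _] := iF; apply: IB.
have gD x y : J x -> J y -> g (x + y) = g x + g y.
  by move=> [s fs <-] [t ft <-]; rewrite -phfunD // !gf //; apply: idealD.
have gM x a : J x -> g (x * a) = g x * a.
  by move=> [s fs <-]; rewrite -phfunM // !gf //; apply: idealMr.
pose h := PartialHom iJ J0 gD gM.
have zw : pi f * pi h = 1.
  rewrite pi_mulE; apply/ph_piP; apply: (ph_equivT primeA) => x + _ /=.
  move=> /(ideal_mul_sub iJ iF)[/gP[_ e] _]; by rewrite e mul1r.
have wz : pi h * pi f = 1.
  rewrite pi_mulE; apply/ph_piP; apply: (ph_equivT primeA) => x + _ /=.
  by move=> /(ideal_mul_sub iF iJ)[/gf -> _]; rewrite mul1r.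
exists (pi h); split=> // q.
by rewrite -[in LHS](mulr1 q) -zw (mulrA q) -(zf q) !mulrA wz mul1r.
Qed.

Definition centre_pred : {pred Q} := fun z => `[< extended_centre z >].

Fact centre_subring : subring_closed centre_pred.
Proof.
split=> [|x y /asboolP cx /asboolP cy|x y /asboolP cx /asboolP cy]; apply/asboolP => q.
- by rewrite mul1r mulr1.
- by rewrite mulrBl mulrBr cx cy.
- by rewrite -mulrA cy mulrA cx mulrA.
Qed.

Record centre := Centre { centre_val :> Q; centre_valP : centre_val \in centre_pred }.

HB.instance Definition _ := [isSub for centre_val].
HB.instance Definition _ := [Choice of centre by <:].
HB.instance Definition _ :=
  GRing.SubChoice_isSubNzRing.Build Q centre_pred centre centre_subring.

Lemma centreP (c : centre) : extended_centre (c : Q).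
Proof. by have /asboolP := centre_valP c. Qed.

Fact centre_mulC : @commutative centre centre *%R.
Proof. by move=> x y; apply: val_inj; rewrite !rmorphM; apply: centreP. Qed.

HB.instance Definition _ := GRing.PzRing_hasCommutativeMul.Build centre centre_mulC.

Fact centre_has_inverse (c : centre) :
  exists w : centre, if c == 0 then w = 0 else w * c = 1.
Proof.
have [_|c0] := eqVneq c 0; first by exists 0.
have cQ0 : (c : Q) != 0.
  by apply: contraNneq c0 => e; apply/eqP/val_inj; rewrite rmorph0.
have [w [cw zw wz]] := centre_inverse (centreP c) cQ0.
exists (Centre (introT (asboolP _) cw)).
by apply: val_inj; rewrite rmorphM rmorph1.
Qed.

Definition centre_inv (c : centre) : centre := projT1 (cid (centre_has_inverse c)).

Fact centre_mulVf (c : centre) : c != 0 -> centre_inv c * c = 1.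
Proof. by rewrite /centre_inv; case: cid => w /=; case: eqP. Qed.

Fact centre_inv0 : centre_inv 0 = 0.
Proof. by rewrite /centre_inv; case: cid => w /=; rewrite eqxx. Qed.

HB.instance Definition _ := GRing.ComNzRing_isField.Build centre centre_mulVf centre_inv0.

Definition centre_scale (c : centre) (q : Q) : Q := val c * q.

Fact centre_scaleA c d q : centre_scale c (centre_scale d q) = centre_scale (c * d) q.
Proof. by rewrite /centre_scale rmorphM mulrA. Qed.
Fact centre_scale1 : left_id 1 centre_scale.
Proof. by move=> q; rewrite /centre_scale rmorph1 mul1r. Qed.
Fact centre_scaleDr : right_distributive centre_scale +%R.
Proof. by move=> c p q; rewrite /centre_scale mulrDr. Qed.
Fact centre_scaleDl q : {morph centre_scale^~ q : c d / c + d}.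
Proof. by move=> c d; rewrite /centre_scale rmorphD mulrDl. Qed.

HB.instance Definition _ := GRing.Zmodule_isLmodule.Build centre Q
  centre_scaleA centre_scale1 centre_scaleDr centre_scaleDl.

Fact centre_scaleAl (c : centre) (p q : Q) : c *: (p * q) = c *: p * q.
Proof. by rewrite /GRing.scale /= /centre_scale mulrA. Qed.

HB.instance Definition _ := GRing.Lmodule_isLalgebra.Build centre Q centre_scaleAl.

Fact centre_scaleAr (c : centre) (p q : Q) : c *: (p * q) = p * (c *: q).
Proof. by rewrite /GRing.scale /= /centre_scale !mulrA (centreP c). Qed.

HB.instance Definition _ := GRing.Lalgebra_isAlgebra.Build centre Q centre_scaleAr.

Lemma iota_scalar_centre (k : K) : iota k%:A \in centre_pred.
Proof.
apply/asboolP; elim/mpiW => f; rewrite /mlmul !pi_mulE; apply/ph_piP.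
apply: (ph_equivT primeA) => x + _ /=.
have iF := phdom_ideal f; have iT := @idealT K A.
by move=> /(ideal_mul_sub iF iT)[fx _]; rewrite !mulr_algl phfunZ.
Qed.

End ExtendedCentre.

(** * Cubic growth and GK dimension *)

Section Growth.
Variables (R : realType).

(** An upper limit below 3 would give D m <= m^r for large m and some r < 3.  With
    m = a n the hypothesis then reads (3 - r) ln n <= (1 + r) ln a. *)
Lemma cubic_growth_GK (D : nat -> nat) a :
  (forall n, (0 < n)%N -> (n ^ 3 <= a * D (a * n)%N)%N) ->
  (3%:E <= limn_esup (fun n => (ln (D n)%:R / ln n%:R : R)%:E))%E.
Proof.
move=> H; rewrite leNgt; apply/negP => /ereal_inf_lt[_ [B [N _ NB] <-]].
set s := ereal_sup _ => s3.
have uB n : (N <= n)%N -> ((ln (D n)%:R / ln n%:R : R)%:E <= s)%E.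
  by move=> Nn; apply: ereal_sup_ubound; exists n => //; apply: NB.
have [r [r3 ur]] : exists r : R, r < 3 /\
    forall n, (N <= n)%N -> ln (D n)%:R / ln n%:R <= r.
  move: s3 uB; case: s => [r|//|] s3 uB.
    by exists r; split=> // n /uB; rewrite lee_fin.
  by have := uB N (leqnn N); rewrite leeNy_eq.
have a0 : (0 < a)%N by have := H 1%N isT; rewrite lt0n; case: eqP => // ->.
pose T := (1 + r) * ln (a%:R : R) / (3 - r).
pose n := (N + 2 + Num.bound (expR T))%N.
have n1 : (1 < n)%N by rewrite /n; lia.
have n0 : (0 < n)%N by apply: ltnW.
have an1 : (1 < a * n)%N by rewrite (leq_trans n1) // leq_pmull.
have nT : T < ln (n%:R : R).
  rewrite -[T]expRK ltr_ln ?posrE ?expR_gt0 ?ltr0n //.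
  apply: lt_le_trans (archi_boundP (expR_ge0 T)) _.
  by rewrite ler_nat /n leq_addl.
have Dpos : (0 < D (a * n)%N)%N.
  by have := H n n0; rewrite lt0n; case: eqP => // ->; rewrite muln0 leqn0 expn_eq0; lia.
have : ln ((n ^ 3)%:R : R) <= ln ((a * D (a * n)%N)%:R : R).
  by rewrite ler_ln ?posrE ?ltr0n ?muln_gt0 ?a0 ?expn_gt0 ?n0 // ler_nat H.
rewrite natrX lnXn ?ltr0n // natrM lnM ?posrE ?ltr0n //.
have lan : 0 < ln ((a * n)%:R : R) by rewrite ln_gt0 // ltr1n.
have Nan : (N <= a * n)%N.
  by apply: (@leq_trans n); [rewrite /n -addnA leq_addr|rewrite leq_pmull].
have := ur _ Nan; rewrite ler_pdivrMr // natrM lnM ?posrE ?ltr0n // => le1 le2.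
have r3' : 0 < 3 - r by rewrite subr_gt0.
have := nT; rewrite /T ltr_pdivrMr //.
rewrite ltNge => /negP; apply.
rewrite mulrBr mulrDl mul1r lerBlDr -addrA (mulrC _ r) -mulrDr mulr_natr.
by apply: le_trans le2 _; rewrite lerD2l.
Qed.

End Growth.

Section Dimension.
Variables (K : fieldType) (U : lmodType K).

Lemma leq_dim (X : set U) n : fin_gen X -> has_indep X n -> (n <= dim X)%N.
Proof.
move=> gX iX; have [m [b [ib _ XE]]] := fin_gen_basis gX.
have : has_dim X (dim X) by apply: xgetPex; exists m, b.
by move=> [b' _ XE']; apply: (indep_leq (v := b')) iX; rewrite {1}XE'.
Qed.

Lemma fin_dim_fin_gen (X : set U) : fin_dim X -> fin_gen X.
Proof. by move=> [n [b _ XE]]; exists n, b. Qed.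

End Dimension.

(** * Extension of scalars to the extended centre *)

Section ScalarExtension.
Variables (K : fieldType) (A : algType K) (primeA : prime_algebra A).
Local Notation C := (centre primeA).
Local Notation Q := (martindale primeA).
Local Notation iota := (mlmul primeA).

Definition extend (X : set A) : set Q := @span C Q (iota @` X).

Lemma iota_scale (k : K) x :
  iota (k *: x) = (Centre (iota_scalar_centre primeA k) : C) *: (iota x : Q).
Proof. by rewrite -[k *: x]mulr_algl rmorphM. Qed.

Lemma subspace_iota (Z : set Q) : @is_subspace C Q Z -> is_subspace [set x | Z (iota x)].
Proof.
move=> [Z0 ZD]; split=> [|k x y Zx Zy] /=; first by rewrite rmorph0.
by rewrite rmorphD /= iota_scale; apply: ZD.
Qed.

Lemma extend_span (X : set A) : extend (span X) = extend X.
Proof.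
apply/seteqP; split; last by apply: span_mono; apply: image_subset; apply: span_sub.
apply: span_subspace => [|_ [x Xx <-]]; first exact: subspace_span.
move: x Xx; apply: span_subspace; first exact/subspace_iota/subspace_span.
by move=> x Xx; apply: span_sub; exists x.
Qed.

Lemma extend_mul (X Y : set A) : extend X ** extend Y = extend (X ** Y).
Proof.
apply/seteqP; split.
  apply: mul_sub => [|x y + Yy]; first exact: subspace_span.
  move: x; apply: span_subspace => [|_ [x Xx <-]].
    exact: (subspace_rmul y (subspace_span _)).
  move: y Yy; apply: span_subspace => [|_ [y Yy <-]].
    exact: (subspace_lmul (iota x) (subspace_span _)).
  by rewrite /= -rmorphM; apply: span_sub; exists (x * y) => //; apply: mem_mul.
rewrite /ideal_mul extend_span; apply: span_subspace; first exact: subspace_mul.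
move=> _ [_ [x [y [Xx Yy ->]]] <-]; rewrite rmorphM.
by apply: mem_mul; apply: span_sub; [exists x|exists y].
Qed.

Lemma extend_spow (X : set A) n : spow (extend X) n = extend (spow X n).
Proof.
elim: n => [|n IH] /=; last by rewrite IH extend_mul.
rewrite extend_span; congr span; apply/seteqP; split=> [_ ->|_ [_ -> <-]].
  by exists 1 => //; apply: rmorph1.
by rewrite /= rmorph1.
Qed.

Lemma extend_fin_gen (X : set A) : fin_gen X -> fin_gen (extend X).
Proof.
move=> [n [v ->]]; exists n, (iota \o v); rewrite extend_span; congr span.
by rewrite image_comp.
Qed.

Lemma mem_extend (X : set A) x : X x -> extend X (iota x).
Proof. by move=> Xx; apply: span_sub; exists x. Qed.

End ScalarExtension.

Arguments extend {K A} primeA X.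

(** * A transcendental central element forces cubic growth *)

Section TranscendentalCentre.
Variables (K : fieldType) (A : algType K) (V : set A).
Hypotheses (frameV : is_frame V) (primeA : prime_algebra A) (nPI : ~ is_PI A).
Local Notation C := (centre primeA).
Local Notation Q := (martindale primeA).
Local Notation iota := (mlmul primeA).

Lemma frame_fin_gen : fin_gen V.
Proof. by case: frameV => /fin_dim_fin_gen. Qed.

Lemma frame1 : V 1.
Proof. by case: frameV. Qed.

Lemma frame_generates x : exists n, spow V n x.
Proof.
have [_ V1 VT] := frameV; have sV := fin_gen_subspace frame_fin_gen.
have : [set: A] x by []; rewrite -VT.
apply: (@smallest_sub _ _ _ [set y | exists n, spow V n y]) => [|v Vv]; last first.
  by exists 1%N; rewrite spow1.
split=> [|k u v|u v]; rewrite ?inE; first by exists 1%N; rewrite spow1.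
  move=> [m Vu] [n Vv]; exists (m + n)%N; have [_ sD] := subspace_spow V (m + n).
  by apply: sD; [apply: (spow_leq V1 (leq_addr n m))|apply: (spow_leq V1 (leq_addl m n))].
by move=> [m Vu] [n Vv]; exists (m + n)%N; rewrite spowD; apply: mem_mul.
Qed.

Lemma frame_contains (I : finType) (f : I -> A) : exists d, forall i, spow V d (f i).
Proof.
have /choice[n nP] := fun i => frame_generates (f i).
by exists (\max_i n i) => i; apply: (spow_leq frame1 (leq_bigmax i)).
Qed.

Lemma extended_prime : prime_generators (extend primeA V).
Proof.
move=> p q p0 q0; have [a paq] := martindale_prime p0 q0.
have [n Va] := frame_generates a; exists n, (iota a); split=> //.
by rewrite extend_spow; apply: mem_extend.
Qed.

Lemma extended_not_PI : no_standard_identity (extend primeA V).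
Proof.
move=> N; have [x x0] := not_PI_standard nPI N; have [d Vd] := frame_contains x.
exists d, (iota \o x); split=> [i|].
  by rewrite extend_spow; apply: mem_extend.
rewrite -standard_rmorph; apply: contraNneq x0.
by rewrite -(rmorph0 iota) => /mlmul_inj ->.
Qed.

Variables (z : Q) (cz : extended_centre z).

Definition multipliers : set A := [set x | exists y, z * iota x = iota y].

Lemma multipliers_ideal : is_ideal multipliers.
Proof.
apply/idealP; split=> [|x y [x' ex] [y' ey]|a x [x' ex]|a x [x' ex]].
- by exists 0; rewrite rmorph0 mulr0.
- by exists (x' - y'); rewrite !rmorphB mulrBr; congr (_ - _).
- by exists (a * x'); rewrite !rmorphM mulrA (cz (iota a)) -mulrA; congr (_ * _).
- by exists (x' * a); rewrite !rmorphM mulrA; congr (_ * _).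
Qed.

(** The domain of a map that represents z consists of multipliers. *)
Lemma multipliers_neq0 : multipliers <> [set 0].
Proof.
rewrite /multipliers -[z]reprK => I0; set f := repr z in I0.
have /(neq_set0P (phdom_ideal f))[x fx x0] := @phdom_neq0 _ _ f.
apply: x0; have : [set x | exists y, \pi_Q f * iota x = iota y] x.
  by exists (phfun f x); apply: pi_mul_iota.
by rewrite I0.
Qed.

Lemma subspace_multiplied i (X : set A) : is_subspace X ->
  is_subspace [set x | exists2 y, X y & z ^+ i * iota x = iota y].
Proof.
move=> [X0 XD]; split=> [|k x y [x' Xx ex] [y' Xy ey]] /=.
  by exists 0 => //; rewrite rmorph0 mulr0.
exists (k *: x' + y'); first exact: XD.
by rewrite !rmorphD /= !iota_scale mulrDr -scalerAr ex ey (iota_scale primeA k x').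
Qed.

Lemma central_exp i q : z ^+ i * q = q * z ^+ i.
Proof.
elim: i => [|i IH]; first by rewrite expr0 mulr1 mul1r.
by rewrite exprS -mulrA IH mulrA cz mulrA.
Qed.

Lemma multiplied_power (W X : set A) : is_subspace X ->
  W `<=` X -> (forall w, W w -> exists2 y, X y & z * iota w = iota y) ->
  forall n i x, (i <= n)%N -> spow W n x ->
    exists2 y, spow X n y & z ^+ i * iota x = iota y.
Proof.
move=> sX WX zW; elim=> [|n IH] i x.
  by rewrite leqn0 => /eqP -> Wx; exists x; rewrite // expr0 mul1r.
move=> le_in; move: x; apply: mul_sub => [|w x Ww Wx].
  exact/subspace_multiplied/subspace_mul.
case: i le_in => [|i] le_in.
  have [y Xy ey] := IH 0%N x (leq0n n) Wx; exists (w * y).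
    by apply: mem_mul => //; apply: WX.
  by move: ey; rewrite expr0 !mul1r !rmorphM /= => ->.
have [w' Xw' ew] := zW w Ww; have [y Xy ey] := IH i x le_in Wx.
exists (w' * y); first exact: mem_mul.
by rewrite !rmorphM /= -ew -ey exprSr mulrA -(mulrA _ z) central_exp -!mulrA.
Qed.

Hypothesis tz : forall p : {poly K}, p != 0 ->
  ~~ root (map_poly (iota \o in_alg A) p) z.
Hypothesis noLN : forall I : set A, is_ideal I -> locally_nilpotent I -> I = [set 0].

(** The c i are the coefficients of a polynomial which vanishes at z. *)
Lemma powers_independent n (c : 'I_n -> K) :
  \sum_i iota (c i)%:A * z ^+ i = 0 -> forall i, c i = 0.
Proof.
move=> c0 i; pose p := \poly_(j < n) (if insub j is Some k then c k else 0).
have pE (j : 'I_n) : p`_j = c j by rewrite coef_poly ltn_ord valK.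
rewrite -pE; suff -> : p = 0 by rewrite coef0.
apply/eqP/negPn/negP => /tz/negP; apply; apply/rootP.
rewrite (@horner_coef_wide _ n); last first.
  by apply: leq_trans (size_poly _ _) _; rewrite size_poly.
rewrite -[RHS]c0; apply: eq_bigr => j _.
by rewrite coef_map pE.
Qed.

(** A relation over K between the z^i y_j is a relation over the extended centre
    between the y_j, whose coefficients are polynomials in z. *)
Lemma multiplied_indep n N (y : 'I_N -> Q) (X : set A) :
  @lin_indep C Q N y ->
  (forall j i, (i <= n)%N -> exists2 x, X x & z ^+ i * y j = iota x) ->
  has_indep X (n.+1 * N).
Proof.
move=> iy zy.
have /choice[x xP] : forall ij : 'I_n.+1 * 'I_N, exists x,
    X x /\ z ^+ ij.1 * y ij.2 = iota x.
  by move=> [i j]; have [x Xx e] := zy j i (leq_ord i); exists x.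
have -> : (n.+1 * N = #|{: 'I_n.+1 * 'I_N}|)%N by rewrite card_prod !card_ord.
apply: (@indep_has_indep _ _ _ x) => [c c0 [i j]|ij]; last by case: (xP ij).
apply: (@powers_independent _ (fun i => c (i, j))).
pose zc : C := Centre (introT (asboolP _) cz).
pose e j : C := \sum_(i < n.+1)
  (Centre (iota_scalar_centre primeA (c (i, j))) : C) * zc ^+ i.
have eE j' : val (e j') = \sum_(i < n.+1) iota (c (i, j'))%:A * z ^+ i.
  by rewrite rmorph_sum; apply: eq_bigr => k _; rewrite rmorphM rmorphXn.
rewrite -eE (iy e) ?rmorph0 //.
transitivity (iota (\sum_ij c ij *: x ij)); last by rewrite c0 rmorph0.
rewrite sum_pair exchange_big raddf_sum; apply: eq_bigr => k _.
rewrite raddf_sum scaler_suml; apply: eq_bigr => l _ /=.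
rewrite iota_scale -(xP (l, k)).2 /= -scalerA; congr (_ *: _).
rewrite /GRing.scale /= /centre_scale; congr (_ * _).
by rewrite rmorphXn.
Qed.

Lemma cubic_growth : exists a, forall n, (0 < n)%N ->
  (n ^ 3 <= a * dim (space_exp V (a * n)))%N.
Proof.
have gV := frame_fin_gen; have V1 := frame1; have sV := fin_gen_subspace gV.
have [W [fW WI nW]] : exists W : set A, [/\ fin_dim W, W `<=` multipliers
    & forall n, (0 < n)%N -> space_exp W n <> [set 0]].
  apply: contrapT => nW; apply: multipliers_neq0; apply: noLN.
    exact: multipliers_ideal.
  move=> W fW WI; apply: contrapT => nn; apply: nW; exists W; split=> // n n0 Wn.
  by apply: nn; exists n.
have gW := fin_dim_fin_gen fW; have [m [w WE]] := gW.
have /choice[w' w'E] : forall i, exists y, z * iota (w i) = iota y.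
  by move=> i; apply: WI; rewrite WE; apply: span_sub; exists i.
have [d dP] := frame_contains (fun s : 'I_m + 'I_m =>
  match s with inl i => w i | inr i => w' i end).
have sVd := subspace_spow V d.
have WV : W `<=` spow V d.
  by rewrite WE; apply: span_subspace => // _ [i _ <-]; apply: (dP (inl i)).
have zW x : W x -> exists2 y, spow V d y & z * iota x = iota y.
  rewrite WE; move: x; apply: span_subspace.
    by have := @subspace_multiplied 1 _ sVd; rewrite expr1.
  by move=> _ [i _ <-] /=; exists (w' i) => //; apply: (dP (inr i)).
have [c H] : quadratic (extend primeA V) (extend primeA W).
  apply: (@quadratic_weight _ _ _ _ _ extended_prime extended_not_PI _ d).
  - exact: extend_fin_gen.
  - rewrite -(rmorph1 iota); exact: mem_extend.
  - exact: extend_fin_gen.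
  - by rewrite extend_spow; apply: span_mono; apply: image_subset.
  move=> n; have [x Wx x0] : exists2 x, spow W n x & x != 0.
    case: n => [|n]; first by exists 1; [apply: span_sub|apply: oner_neq0].
    apply: contrapT => nx; apply: (nW n.+1 isT); rewrite space_expE.
    apply/seteqP; split=> [x Wx|_ ->]; last by case: (subspace_spow W n.+1).
    by apply/eqP/negPn/negP => x0; apply: nx; exists x.
  exists (iota x); first by rewrite extend_spow; apply: mem_extend.
  by apply: contraNneq x0; rewrite -(rmorph0 iota) => /mlmul_inj ->.
exists (4 * c + d + 1)%N => n n0; have [N [nN iN]] := H n.
move: iN; rewrite !extend_spow !extend_mul => /has_indep_span[y iy yE].
have : has_indep (spow V ((4 * c + d + 1) * n)) (n.+1 * N).
  apply: multiplied_indep iy _ => j i le_in; have [x Ex <-] := yE j.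
  have sZ := subspace_multiplied i (subspace_spow V ((4 * c + d + 1) * n)).
  move: x Ex.
  apply: mul_sub => [|u t Vu]; first exact: sZ.
  move: t; apply: mul_sub => [|s v Ws Vv]; first exact: (subspace_lmul u sZ).
  have [y' Vy' ey'] := multiplied_power sVd WV zW le_in Ws.
  exists (u * (y' * v)).
    have : spow V (c * n.+1 + (d * n + c * n.+1)) (u * (y' * v)).
      rewrite !spowD; apply: mem_mul => //; apply: mem_mul => //.
      by rewrite -spowM.
    by apply: (spow_leq V1); nia.
  by rewrite !rmorphM /= -ey' mulrA central_exp -!mulrA.
move=> /leq_dim; rewrite space_expE => le; have {le} le := le (fin_gen_spow _ gV).
set D := dim _ in le *.
apply: (@leq_trans (c * (n.+1 * N))).
  by rewrite expnS mulnC; apply: leq_trans (leq_mul nN (leqnSn n)) _; rewrite -mulnA (mulnC N).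
by apply: leq_mul; lia.
Qed.

End TranscendentalCentre.

Unset Implicit Arguments.

Theorem corollary1p2 (R : realType) (K : fieldType) (A : algType K)
    (V : set A) (frameV : is_frame V) (primeA : prime_algebra A)
    (GKdim_lt3 : (GKdim R V < 3%:E)%E) (nPI : ~ is_PI A)
    (no_locally_nilpotent :
       forall I : set A, is_ideal I -> locally_nilpotent I -> I = [set 0%R]%classic) :
  extended_centre_algebraic primeA.
Proof.
move=> z cz; apply: contrapT => nalg.
have tz (p : {poly K}) : p != 0 -> ~~ root (map_poly (mlmul primeA \o in_alg A) p) z.
  by move=> p0; apply/negP => pz; apply: nalg; exists p.
have [a H] := cubic_growth frameV nPI cz tz no_locally_nilpotent.
by move: GKdim_lt3; rewrite ltNge (@cubic_growth_GK R (fun n => dim (space_exp V n)) a H).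
Qed.
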